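(* Let $k$ be a positive integer, $c\in\{0,1,\dots,k\}$, $n\ge 0$, and let $\lambda$ be a partition contained in $R=(c^{k+1-c})$. Then \[ D_n(\mathbf u_{w_\lambda})=\sum_{\{x_1,\dots,x_n\}\in\mathfrak I}\mathbf u_{\lambda\setminus\{x_1,\dots,x_n\}}, \] where $\mathfrak I$ is the set of all sets of $n$ distinct cells $x_1=(i_1,j_1),\dots,x_n=(i_n,j_n)$ of $\lambda$ satisfying (C1): if $a\ne b$ then $j_a\ne j_b$; and (C2): if $i_a>i_b$ and $j_a<j_b$ for some $a,b$, then $(i_a,j_b)\notin\lambda$.
   Context: Affine symmetric group $W$: bijections $w:\mathbb Z\to\mathbb Z$ with $w(m+k+1)=w(m)+k+1$ and $\sum_{m=1}^{k+1}w(m)=\sum_{m=1}^{k+1}m$. For $r\in\{0,\dots,k\}$, $s_r$ exchanges $r+t(k+1)$ and $r+1+t(k+1)$ for all $t\in\mathbb Z$; $s_a:=s_{a\bmod(k+1)}$. $\ell$ is Coxeter length w.r.t. $s_0,\dots,s_k$. For $i\not\equiv j$ mod $k+1$, $t_{i,j}$ exchanges $i+t(k+1)$ and $j+t(k+1)$ for all $t$ and fixes other integers. Affine nilCoxeter algebra $\mathbb A$: generated by $\mathbf u_0,\dots,\mathbf u_k$ with $\mathbf u_r^2=0$, braid relations $\mathbf u_r\mathbf u_{r+1}\mathbf u_r=\mathbf u_{r+1}\mathbf u_r\mathbf u_{r+1}$ (indices mod $k+1$) and $\mathbf u_r\mathbf u_q=\mathbf u_q\mathbf u_r$ if $r-q\not\equiv\pm1$;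 basis $\mathbf u_w=\mathbf u_{r_1}\cdots\mathbf u_{r_m}$ for $w=s_{r_1}\cdots s_{r_m}$ reduced. Marked strong order graph: directed multigraph with vertex set $W$; for $x,y\in W$ with $\ell(x)=\ell(y)+1$ and for every pair of integers $(i,j)$ with $i\le 0<j$ and $y\,t_{i,j}=x$, there is an edge $x\to y$ labelled $y(j)$. A strong strip of length $n$ from $w$ to $v$ is a path $w\xrightarrow{\ell_1}w_1\xrightarrow{\ell_2}\cdots\xrightarrow{\ell_n}w_n=v$ in this graph with $\ell_1>\ell_2>\cdots>\ell_n$. The linear operator $D_n:\mathbb A\to\mathbb A$ is $D_n(\mathbf u_w)=\sum\mathbf u_v$ summed over all strong strips of length $n$ starting at $w$ (with $v$ the endpoint). Diagrams: cell $(a,b)$ is in row $a$ (from the top) and column $b$ (from the left); content $b-a$, residue $(b-a)\bmod(k+1)$. For a set $\mathcal D$ of cells, read the cells starting in the bottom row, each row right to left, rows bottom to top; with residues $r_1,\dots,r_m$ in this order, $w_{\mathcal D}=s_{r_1}\cdots s_{r_m}$ and $\mathbf u_{\mathcal D}=\mathbf u_{r_1}\cdots\mathbf u_{r_m}$. $w_\lambda=w_{\mathcal D}$ for the diagram of $\lambda$, and $\lambda\setminus X$ is the diagram of $\lambda$ with the cells of $X$ removed.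
   Formalization: For k = 1 no braid relation is imposed between u_0 and u_1, since u_0u_1u_0 = u_1u_0u_1 would identify distinct elements u_w and contradict that the u_w form a basis, leaving D_n undefined; for k ≥ 2 the relations are as stated. *)

(* Defs.v *)
From HB Require Import structures.
From mathcomp Require Import all_boot all_order all_algebra.
From mathcomp Require Import generic_quotient ring_quotient finmap monalg.
From mathcomp Require Import boolp classical_sets fsbigop.

Set Implicit Arguments.
Unset Strict Implicit.
Unset Printing Implicit Defensive.

Import Order.TTheory GRing.Theory Num.Theory.
Local Open Scope classical_set_scope.
Local Open Scope ring_scope.
Local Open Scope quotient_scope.

Section AffineSymmetricGroup.

Variable k : nat.

Definition affine_perm : set (int -> int) :=
  [set w | [/\ bijective w,
               forall m, w (m + k.+1%:Z) = w m + k.+1%:Z &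
               \sum_(1 <= m < k.+2) w m%:Z = \sum_(1 <= m < k.+2) m%:Z]].

(* A transposition only when i and j are distinct modulo k.+1. *)
Definition transp (i j : int) : int -> int := fun m =>
  if (m == i %[mod k.+1])%Z then m + (j - i)
  else if (m == j %[mod k.+1])%Z then m + (i - j) else m.

Definition simple (r : 'I_k.+1) : int -> int := transp r%:Z (r%:Z + 1).

Definition word_perm (s : seq 'I_k.+1) : int -> int :=
  foldr (fun r w => simple r \o w) id s.

Definition is_reduced_word (w : int -> int) (s : seq 'I_k.+1) : Prop :=
  word_perm s = w /\ forall s', word_perm s' = w -> (size s <= size s')%N.

(* Every w in affine_perm has a reduced word; [::] is a junk value elsewhere. *)
Definition reduced_word (w : int -> int) : seq 'I_k.+1 :=
  xget [::] [set s | is_reduced_word w s].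

Definition coxeter_length (w : int -> int) : nat := size (reduced_word w).

(* An edge x -> y of the marked strong order graph is stored, relative to its
   source x, as (i, j, y): distinct pairs (i, j) give distinct edges. *)
Definition strong_edge (x : int -> int) (e : int * int * (int -> int)) : Prop :=
  let: (i, j, y) := e in
  [/\ affine_perm x, affine_perm y, coxeter_length x = (coxeter_length y).+1,
      i <= 0 < j & (i != j %[mod k.+1])%Z /\ y \o transp i j = x].

Definition edge_label (e : int * int * (int -> int)) : int :=
  let: (i, j, y) := e in y j.

Fixpoint strong_path (x : int -> int) (p : seq (int * int * (int -> int))) :
    Prop :=
  if p is e :: p' then strong_edge x e /\ strong_path e.2 p' else True.

Definition strong_strip (n : nat) (x : int -> int) :
    set (seq (int * int * (int -> int))) :=
  [set p | [/\ size p = n, strong_path x p &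
               sorted (fun a b : int => b < a) [seq edge_label e | e <- p]]].

Definition strip_end (x : int -> int) (p : seq (int * int * (int -> int))) :
    int -> int :=
  last x [seq e.2 | e <- p].

End AffineSymmetricGroup.

Section GeneratedIdeal.

Variable A : nzRingType.

Definition two_sided_ideal (J : set A) : Prop :=
  [/\ J 0, forall x y, J x -> J y -> J (x - y),
      forall a x, J x -> J (a * x) & forall a x, J x -> J (x * a)].

Definition ideal_gen (S : set A) : set A :=
  [set x | forall J, two_sided_ideal J -> S `<=` J -> J x].

Lemma ideal_gen_two_sided S : two_sided_ideal (ideal_gen S).
Proof.
split=> [J [] //|x y Ix Iy J JI SJ|a x Ix J JI SJ|a x Ix J JI SJ].
- by case: (JI) => _ JB _ _; apply: JB; [apply: Ix|apply: Iy].
- by case: (JI) => _ _ JM _; apply: JM; apply: Ix.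
- by case: (JI) => _ _ _ JM; apply: JM; apply: Ix.
Qed.

End GeneratedIdeal.

Section NilCoxeter.

Variables (R : comNzRingType) (k : nat).

Local Notation FA := {malg R[{fmonom 'I_k.+1}]}.

Definition free_gen (r : 'I_k.+1) : FA := << fmu r >>.

(* For k = 1 the nodes 0 and 1 are joined by an edge labelled oo and there is
   no braid relation between them. *)
Definition nilCoxeter_rel : set FA :=
  [set x | [\/ exists r, x = free_gen r * free_gen r,
               (1 < k)%N /\ exists r, x =
                 free_gen r * free_gen (ordS r) * free_gen r
                 - free_gen (ordS r) * free_gen r * free_gen (ordS r) |
               exists r q, [/\ q != ordS r, r != ordS q &
                 x = free_gen r * free_gen q - free_gen q * free_gen r]]].

Definition nilCoxeter_ideal : {pred FA} :=
  [pred x | `[< ideal_gen nilCoxeter_rel x >]].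

Local Notation I := nilCoxeter_ideal.

Lemma nilCoxeter_idealP x : reflect (ideal_gen nilCoxeter_rel x) (x \in I).
Proof. exact: asboolP. Qed.

Lemma nilCoxeter_ideal_zmod : zmod_closed I.
Proof.
have [I0 IB _ _] := ideal_gen_two_sided nilCoxeter_rel.
split; first exact/nilCoxeter_idealP.
move=> x y /nilCoxeter_idealP Ix /nilCoxeter_idealP Iy.
by apply/nilCoxeter_idealP; apply: IB.
Qed.

HB.instance Definition _ :=
  GRing.isZmodClosed.Build FA nilCoxeter_ideal nilCoxeter_ideal_zmod.

Lemma nilCoxeter_idealMl a x : x \in I -> a * x \in I.
Proof.
have [_ _ IM _] := ideal_gen_two_sided nilCoxeter_rel.
by move=> /nilCoxeter_idealP Ix; apply/nilCoxeter_idealP; apply: IM.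
Qed.

Lemma nilCoxeter_idealMr a x : x \in I -> x * a \in I.
Proof.
have [_ _ _ IM] := ideal_gen_two_sided nilCoxeter_rel.
by move=> /nilCoxeter_idealP Ix; apply/nilCoxeter_idealP; apply: IM.
Qed.

Local Notation cst := (@mcoeff _ R (mone : {fmonom 'I_k.+1})).

Lemma free_gen_const r : cst (free_gen r) = 0 :> R.
Proof. by rewrite /free_gen mcoeffU1 -val_eqE /= fmU fm1. Qed.

Lemma nilCoxeter_ideal1 : 1 \notin I.
Proof.
apply/negP => /nilCoxeter_idealP /(_ [set x : FA | cst x = 0]) H.
have: cst (1 : FA) = 0 :> R; last first.
  by move/eqP; rewrite rmorph1 oner_eq0.
apply: H.
  split=> [|x y /= x0 y0|a x /= x0|a x /= x0]; first by rewrite /= raddf0.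
  - by rewrite raddfB /= x0 y0 subr0.
  - by rewrite rmorphM /= x0 mulr0.
  - by rewrite rmorphM /= x0 mul0r.
by move=> x [[r ->]|[_ [r ->]]|[r [q [_ _ ->]]]] /=;
  rewrite ?raddfB /= !rmorphM /= !free_gen_const !(mul0r, subr0).
Qed.

Definition nilCoxeter : Type := Quotient.quot nilCoxeter_ideal.

HB.instance Definition _ := GRing.Zmodule.on nilCoxeter.
HB.instance Definition _ := EqQuotient.on nilCoxeter.

Definition nilCoxeter_pi (x : FA) : nilCoxeter := \pi_nilCoxeter x.

Local Notation pi := nilCoxeter_pi.

Lemma nilCoxeter_piP x y : reflect (pi x = pi y) (x - y \in I).
Proof.
by apply: (iffP idP); rewrite Quotient.idealrBE; [move/eqP|move=> H; apply/eqP].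
Qed.

Lemma nilCoxeter_piK (x : nilCoxeter) : pi (repr x) = x.
Proof. exact: reprK. Qed.

Lemma nilCoxeter_piD x y : pi (x + y) = pi x + pi y.
Proof. exact: Quotient.pi_add. Qed.

Lemma nilCoxeter_pi0 : pi 0 = 0.
Proof.
by rewrite /pi -[RHS](@pi_zeror _ _ _ _ _ (Quotient.quot nilCoxeter_ideal)).
Qed.

Definition nilCoxeter_one : nilCoxeter := pi 1.
Definition nilCoxeter_mul (x y : nilCoxeter) : nilCoxeter :=
  pi (repr x * repr y).
Definition nilCoxeter_scale (a : R) (x : nilCoxeter) : nilCoxeter :=
  pi (a *: repr x).

Lemma nilCoxeter_reprB x : repr (pi x) - x \in I.
Proof. by apply/nilCoxeter_piP; rewrite nilCoxeter_piK. Qed.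

Lemma nilCoxeter_piM x y : pi (x * y) = nilCoxeter_mul (pi x) (pi y).
Proof.
apply/esym/nilCoxeter_piP.
rewrite -[_ - _](subrKA (x * repr (pi y))) -mulrBl -mulrBr.
apply: rpredD; first exact/nilCoxeter_idealMr/nilCoxeter_reprB.
exact/nilCoxeter_idealMl/nilCoxeter_reprB.
Qed.

Lemma nilCoxeter_piZ a x : pi (a *: x) = nilCoxeter_scale a (pi x).
Proof.
apply/esym/nilCoxeter_piP; rewrite -scalerBr -mul_malgC.
exact/nilCoxeter_idealMl/nilCoxeter_reprB.
Qed.

Lemma nilCoxeter_mulA : associative nilCoxeter_mul.
Proof.
move=> x y z; rewrite -[x]nilCoxeter_piK -[y]nilCoxeter_piK.
by rewrite -[z]nilCoxeter_piK -!nilCoxeter_piM mulrA.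
Qed.

Lemma nilCoxeter_mul1 : left_id nilCoxeter_one nilCoxeter_mul.
Proof. by move=> x; rewrite -[x]nilCoxeter_piK -nilCoxeter_piM mul1r. Qed.

Lemma nilCoxeter_mulr1 : right_id nilCoxeter_one nilCoxeter_mul.
Proof. by move=> x; rewrite -[x]nilCoxeter_piK -nilCoxeter_piM mulr1. Qed.

Lemma nilCoxeter_mulDl : left_distributive nilCoxeter_mul +%R.
Proof.
move=> x y z; rewrite -[x]nilCoxeter_piK -[y]nilCoxeter_piK.
rewrite -[z]nilCoxeter_piK -nilCoxeter_piD -!nilCoxeter_piM.
by rewrite mulrDl nilCoxeter_piD.
Qed.

Lemma nilCoxeter_mulDr : right_distributive nilCoxeter_mul +%R.
Proof.
move=> x y z; rewrite -[x]nilCoxeter_piK -[y]nilCoxeter_piK.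
rewrite -[z]nilCoxeter_piK -nilCoxeter_piD -!nilCoxeter_piM.
by rewrite mulrDr nilCoxeter_piD.
Qed.

Lemma nilCoxeter_one_neq0 : nilCoxeter_one != 0.
Proof.
apply: contra nilCoxeter_ideal1 => /eqP H; rewrite -[1]subr0.
by apply/nilCoxeter_piP; rewrite nilCoxeter_pi0.
Qed.

HB.instance Definition _ := GRing.Zmodule_isNzRing.Build nilCoxeter
  nilCoxeter_mulA nilCoxeter_mul1 nilCoxeter_mulr1
  nilCoxeter_mulDl nilCoxeter_mulDr nilCoxeter_one_neq0.

Lemma nilCoxeter_scaleA a b x :
  nilCoxeter_scale a (nilCoxeter_scale b x) = nilCoxeter_scale (a * b) x.
Proof. by rewrite -[x]nilCoxeter_piK -!nilCoxeter_piZ scalerA. Qed.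

Lemma nilCoxeter_scale1 : left_id 1 nilCoxeter_scale.
Proof. by move=> x; rewrite -[x]nilCoxeter_piK -nilCoxeter_piZ scale1r. Qed.

Lemma nilCoxeter_scaleDr : right_distributive nilCoxeter_scale +%R.
Proof.
move=> a x y; rewrite -[x]nilCoxeter_piK -[y]nilCoxeter_piK.
by rewrite -nilCoxeter_piD -!nilCoxeter_piZ scalerDr nilCoxeter_piD.
Qed.

Lemma nilCoxeter_scaleDl x :
  {morph nilCoxeter_scale^~ x : a b / a + b >-> a + b}.
Proof.
move=> a b; rewrite -[x]nilCoxeter_piK -!nilCoxeter_piZ.
by rewrite scalerDl nilCoxeter_piD.
Qed.

HB.instance Definition _ := GRing.Zmodule_isLmodule.Build R nilCoxeter
  nilCoxeter_scaleA nilCoxeter_scale1 nilCoxeter_scaleDr nilCoxeter_scaleDl.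

Lemma nilCoxeter_scaleAl (a : R) (x y : nilCoxeter) :
  a *: (x * y) = a *: x * y.
Proof.
rewrite -[x]nilCoxeter_piK -[y]nilCoxeter_piK /GRing.scale /GRing.mul /=.
by rewrite -nilCoxeter_piM -!nilCoxeter_piZ -nilCoxeter_piM scalerAl.
Qed.

HB.instance Definition _ := GRing.Lmodule_isLalgebra.Build R nilCoxeter
  nilCoxeter_scaleAl.

Lemma free_scaleAr (a : R) (x y : FA) : a *: (x * y) = x * (a *: y).
Proof.
suff xC : x * a%:MP = a%:MP * x by rewrite -!mul_malgC mulrA -xC mulrA.
rewrite !malgM_def fgmulUg fgmulgU; apply: eq_bigr => m _.
by rewrite mulrC mul1m mulm1.
Qed.

Lemma nilCoxeter_scaleAr (a : R) (x y : nilCoxeter) :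
  a *: (x * y) = x * (a *: y).
Proof.
rewrite -[x]nilCoxeter_piK -[y]nilCoxeter_piK /GRing.scale /GRing.mul /=.
by rewrite -nilCoxeter_piM -!nilCoxeter_piZ -nilCoxeter_piM free_scaleAr.
Qed.

HB.instance Definition _ := GRing.Lalgebra_isAlgebra.Build R nilCoxeter
  nilCoxeter_scaleAr.

Definition nc_gen (r : 'I_k.+1) : nilCoxeter := nilCoxeter_pi (free_gen r).

Definition nc_word (s : seq 'I_k.+1) : nilCoxeter := \prod_(r <- s) nc_gen r.

Definition nc_basis (w : int -> int) : nilCoxeter := nc_word (reduced_word k w).

Definition is_down_operator (n : nat) (D : {linear nilCoxeter -> nilCoxeter}) :
    Prop :=
  forall w, affine_perm k w ->
    D (nc_basis w) = \sum_(p \in strong_strip k n w) nc_basis (strip_end w p).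

(* The family (nc_basis w), w in affine_perm k, is a basis of nilCoxeter, so
   exactly one linear map satisfies is_down_operator; the second branch is
   never taken. *)
Definition down_operator (n : nat) : {linear nilCoxeter -> nilCoxeter} :=
  match pselect (exists D, is_down_operator n D) with
  | left exD => sval (cid exD)
  | right _ => \0
  end.

End NilCoxeter.

Section Diagrams.

Definition is_partition (lam : seq nat) : bool :=
  sorted geq lam && (0%N \notin lam).

Definition part_contained (lam mu : seq nat) : Prop :=
  forall a, (nth 0 lam a <= nth 0 mu a)%N.

(* Cells are (row, column), both numbered from 1. *)
Definition diagram (lam : seq nat) : {fset nat * nat} :=
  [fset x in [seq (a, b) | a <- iota 1 (size lam),
                           b <- iota 1 (nth 0%N lam a.-1)]]%fset.

Definition residue (k : nat) (x : nat * nat) : 'I_k.+1 :=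
  inZp (absz ((x.2%:Z - x.1%:Z) %% k.+1)%Z).

(* Bottom row (largest row index) first, each row from right to left. *)
Definition reading_le (x y : nat * nat) : bool :=
  (y.1 < x.1)%N || ((x.1 == y.1) && (y.2 <= x.2)%N).

Definition reading_word (k : nat) (X : {fset nat * nat}) : seq 'I_k.+1 :=
  [seq residue k x | x <- sort reading_le (enum_fset X)].

Definition cells_perm (k : nat) (X : {fset nat * nat}) : int -> int :=
  word_perm (reading_word k X).

Definition nc_cells (R : comNzRingType) (k : nat) (X : {fset nat * nat}) :
    nilCoxeter R k :=
  nc_word R (reading_word k X).

Definition removable_sets (n : nat) (lam : seq nat) : set {fset nat * nat} :=
  [set X | [/\ (X `<=` diagram lam)%fset, #|` X| = n,
     forall x y, x \in X -> y \in X -> x != y -> x.2 != y.2 &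
     forall x y, x \in X -> y \in X -> (y.1 < x.1)%N -> (x.2 < y.2)%N ->
       (x.1, y.2) \notin diagram lam]].

End Diagrams.

(* Main.v *)
Require Import Defs.
From HB Require Import structures.
From mathcomp Require Import all_boot all_order all_algebra finmap monalg.
From mathcomp Require Import boolp classical_sets fsbigop.
From mathcomp Require Import zify.

Set Implicit Arguments.
Unset Strict Implicit.
Unset Printing Implicit Defensive.

Import Order.TTheory GRing.Theory Num.Theory.
Local Open Scope ring_scope.

(* Only the value of D_n at u_{w_lambda} is needed; D_n exists because the map
   "word |-> sum over the strips of its permutation if the word is reduced, 0
   otherwise" on the free algebra kills the nilCoxeter relations.

   Lengths are controlled by the strong exchange property: if p < q and
   w p > w q, then deleting one letter from a word of w gives a word of
   w t_{p,q}.  It yields Matsumoto's theorem (reduced words of the same element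
   have the same product u_w).

   Write w = w_lambda.  Since lambda fits in the rectangle, w preserves the
   window [c - k, c], so that the strong edges below w are the Bruhat covers of
   the symmetric group of the window exchanging a position 1 - a <= 0 (row a) and
   a position b > 0 (column b).  Here w is Grassmannian, and (a, b) is a cell of
   lambda iff w (1 - a) > w b.  Along a strip a column is used at most once
   because labels decrease, and within a row columns are used from right to
   left.  Hence the strip is determined by its set X of cells: the label of (a, b)
   is w b' for the next cell (a, b') of X to the right in the same row, or
   w (1 - a) if there is none, and the edges are sorted by label.  The cover
   condition along this path is equivalent to (C2), and the endpoint is
   w_{lambda \ X} because reflections of different rows commute. *)

(** * The reading order on cells, and minima over lists *)

Lemma reading_le_trans : transitive reading_le.
Proof. by move=> [a b] [a' b'] [a'' b'']; rewrite /reading_le /=; lia. Qed.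

Lemma reading_le_anti : antisymmetric reading_le.
Proof.
move=> [a b] [a' b']; rewrite /reading_le /= => H; congr (_, _); lia.
Qed.

Lemma reading_le_total : total reading_le.
Proof. by move=> [a b] [a' b']; rewrite /reading_le /=; lia. Qed.

(** Selects the cell of smallest label, which becomes the last one of the strip in
    [strip_exists]. *)
Lemma seq_argmin (T : eqType) (f : T -> int) (s : seq T) : s != [::] ->
  exists2 y, y \in s & {in s, forall z, f y <= f z}.
Proof.
elim: s => // y [|z s] IH _.
  by exists y; [rewrite inE|move=> t; rewrite inE => /eqP->].
have [//|u su le_u] := IH; have [le_yu|lt_uy] := leP (f y) (f u).
  exists y; first by rewrite inE eqxx.
  move=> t; rewrite inE => /orP[/eqP->//|/le_u]; exact: le_trans.
exists u; first by rewrite inE su orbT.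
by move=> t; rewrite inE => /orP[/eqP->|/le_u//]; apply: ltW.
Qed.

(** * Words in the affine symmetric group *)

Section AffineGroup.

Variable k : nat.

Local Notation n := (k.+1%:Z).
Local Notation tr := (transp k).

Lemma eqmodP (m i : int) :
  reflect (exists t, m = i + t * n) (m == i %[mod n])%Z.
Proof.
rewrite eqz_mod_dvd; apply: (iffP dvdzP) => -[t Ht]; exists t; lia.
Qed.

Lemma neqmodP (m i : int) :
  reflect (forall t, m <> i + t * n) (m != i %[mod n])%Z.
Proof.
apply: (iffP idP) => [/eqmodP H t E|H]; first by apply: H; exists t.
by apply/eqmodP => -[t /H].
Qed.

(** The order of the tests in [transp] is kept: [TranspR] records that m misses the class of i, so
    the case analysis is valid for any i and j. *)
Variant transp_spec (i j m : int) : int -> Prop :=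
| TranspL t of m = i + t * n : transp_spec i j m (j + t * n)
| TranspR t of (forall u, m <> i + u * n) & m = j + t * n :
    transp_spec i j m (i + t * n)
| TranspN of (forall u, m <> i + u * n) & (forall u, m <> j + u * n) :
    transp_spec i j m m.

Lemma transpP i j m : transp_spec i j m (tr i j m).
Proof.
rewrite /transp; case: eqmodP => [[t ->]|Ni].
  have -> : i + t * n + (j - i) = j + t * n by lia.
  by constructor.
have {}Ni u : m <> i + u * n by move=> E; apply: Ni; exists u.
case: eqmodP => [[t E]|Nj]; last first.
  by constructor=> // u E; apply: Nj; exists u.
have -> : m + (i - j) = i + t * n by lia.
by constructor.
Qed.

Lemma transpL i j : tr i j i = j.
Proof.
case: transpP => [t E|t /(_ 0)|/(_ 0)]; [|lia|lia].
have : t * n = 0 by lia.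
by lia.
Qed.

Lemma transpR i j : (i != j %[mod n])%Z -> tr i j j = i.
Proof.
move/neqmodP=> Nij; case: transpP => [t E|t _ E|_ /(_ 0)]; last by lia.
  by case: (Nij (- t)); lia.
have : t * n = 0 by lia.
by lia.
Qed.

Lemma transpN i j m :
  (m != i %[mod n])%Z -> (m != j %[mod n])%Z -> tr i j m = m.
Proof. by rewrite /transp => /negPf-> /negPf->. Qed.

Definition periodic (f : int -> int) := forall m, f (m + n) = f m + n.

Lemma periodicM f : periodic f -> forall t m, f (m + t * n) = f m + t * n.
Proof.
move=> Pf; elim/int_ind => [m|t IH m|t IH m]; first by rewrite !mul0r !addr0.
  have -> : m + t.+1%:Z * n = m + t%:Z * n + n by lia.
  by rewrite Pf IH; lia.
apply: (@addIr _ n); rewrite -Pf.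
have -> : m + - t.+1%:Z * n + n = m + - t%:Z * n by lia.
by rewrite IH; lia.
Qed.

Lemma periodic_comp f g : periodic f -> periodic g -> periodic (f \o g).
Proof. by move=> Pf Pg m /=; rewrite Pg Pf. Qed.

Lemma transp_periodic i j : periodic (tr i j).
Proof.
by move=> m; rewrite /transp !modzDr; case: ifP => _; [|case: ifP => _]; lia.
Qed.

Lemma transpK i j : (i != j %[mod n])%Z -> involutive (tr i j).
Proof.
move/neqmodP=> Nij m; have Pt := periodicM (transp_periodic i j).
case: (transpP i j m) => [t ->|t _ ->|Ni Nj].
- by rewrite Pt transpR //; apply/neqmodP.
- by rewrite Pt transpL.
- by rewrite transpN //; apply/neqmodP.
Qed.

(** Trades a reflection on positions, acting on the right, for the corresponding reflection on
    values, acting on the left. *)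
Lemma transp_conj f p q :
  periodic f -> injective f -> f \o tr p q = tr (f p) (f q) \o f.
Proof.
move=> Pf If; apply/funext => m /=; have PM := periodicM Pf.
case: (transpP p q m) => [t ->|t Np E|Np Nq]; rewrite ?PM.
- by rewrite (periodicM (transp_periodic _ _)) transpL.
- rewrite E PM (periodicM (transp_periodic _ _)) transpR //.
  apply/neqmodP => u; rewrite -PM => /If Epq; apply: (Np (t - u)); lia.
- rewrite transpN //; apply/neqmodP => u; rewrite -PM => /If.
    exact: Np.
  exact: Nq.
Qed.

Lemma transp_shift t i j : tr (i + t * n) (j + t * n) = tr i j.
Proof.
apply/funext => m; rewrite /transp ![_ + t * n]addrC !modzMDl.
by case: ifP => _; [|case: ifP => _]; lia.
Qed.

Lemma neqmod_lt i j : i < j < i + n -> (i != j %[mod n])%Z.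
Proof.
move=> Hij; apply/neqmodP => t E; have [t0|t0] := leP 0 t.
  have : 0 <= t * n by apply: mulr_ge0.
  by lia.
have : (t + 1) * n <= 0 by apply: mulr_le0_ge0; lia.
by lia.
Qed.

Hypothesis k_gt0 : (0 < k)%N.

Lemma neqmodS i : (i != i + 1 %[mod n])%Z.
Proof. by apply: neqmod_lt; lia. Qed.

(** An adjacent transposition moves integers by at most one, so it can reverse the order of two
    integers only if they are neighbours that it exchanges. *)
Lemma transp_flip a u v :
  u < v -> tr a (a + 1) v < tr a (a + 1) u ->
  exists2 t, u = a + t * n & v = u + 1.
Proof.
case: (transpP a (a + 1) u) => [t Eu|t Nu Eu|Nu Nu'];
case: (transpP a (a + 1) v) => [t' Ev|t' Nv Ev|Nv Nv'].
- by lia.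
- move=> H1 H2; exists t => //; have : t' = t by nia.
  by lia.
- move=> H1 H2; case: (Nv' t); lia.
- by nia.
- by lia.
- lia.
- move=> H1 H2; case: (Nu t'); lia.
- lia.
- lia.
Qed.

Definition res (z : int) : 'I_k.+1 := inZp (absz (z %% n)%Z).

Lemma simple_res z : simple (res z) = tr z (z + 1).
Proof.
rewrite /simple /res /=.
have mz : 0 <= (z %% n)%Z < n by rewrite modz_ge0 // ltz_pmod.
have -> : (absz (z %% n)%Z %% k.+1)%N%:Z = (z %% n)%Z.
  by rewrite modn_small; lia.
rewrite -(transp_shift (z %/ n)%Z) {3 4}(divz_eq z n).
by congr (tr _ _); lia.
Qed.

Lemma simpleE (r : 'I_k.+1) : simple r = tr r%:Z (r%:Z + 1).
Proof. by []. Qed.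

Lemma simpleK (r : 'I_k.+1) : involutive (simple r).
Proof. exact/transpK/neqmodS. Qed.

Lemma simple_periodic (r : 'I_k.+1) : periodic (simple r).
Proof. exact: transp_periodic. Qed.

Lemma word_perm_periodic (s : seq 'I_k.+1) : periodic (word_perm s).
Proof.
elim: s => [//|r s IH] /=.
exact: periodic_comp (simple_periodic r) IH.
Qed.

Lemma word_perm_bij (s : seq 'I_k.+1) : bijective (word_perm s).
Proof.
elim: s => [|r s IH] /=; first by exists id.
by apply: bij_comp => //; exists (simple r); apply: simpleK.
Qed.

Lemma word_perm_inj (s : seq 'I_k.+1) : injective (word_perm s).
Proof. exact/bij_inj/word_perm_bij. Qed.

Lemma word_perm_cat (s1 s2 : seq 'I_k.+1) :
  word_perm (s1 ++ s2) = word_perm s1 \o word_perm s2.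
Proof. by elim: s1 => [//|r s IH] /=; rewrite IH. Qed.

Lemma word_perm_rcons (s : seq 'I_k.+1) r :
  word_perm (rcons s r) = word_perm s \o simple r.
Proof. by rewrite -cats1 word_perm_cat. Qed.

(** Letters act from the right end of the word, and some letter first puts the images of p and q in
    the wrong order. By [transp_flip] that letter exchanges these two images, so deleting it amounts
    to multiplying by [tr p q] on the right. *)
Lemma strong_exchange (s : seq 'I_k.+1) (p q : int) :
  p < q -> word_perm s q < word_perm s p ->
  exists2 s' : seq 'I_k.+1, size s = (size s').+1 & word_perm s' = word_perm s \o tr p q.
Proof.
move=> ltpq; elim: s => [|a s IH] /=; first by lia.
set v := word_perm s => Hlt.
have [Hv|Hv|/word_perm_inj Hv] := ltgtP (v p) (v q); last by lia.
  have [t Ep Eq] := transp_flip Hv Hlt.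
  exists s => //; apply/funext => m /=.
  have /(congr1 (fun f => f m)) /= :=
    transp_conj p q (@word_perm_periodic s) (@word_perm_inj s).
  rewrite -/v Eq Ep -addrAC transp_shift => ->.
  by rewrite -simpleE simpleK.
have [s' Es' Ps'] := IH Hv; exists (a :: s'); first by rewrite /= Es'.
by rewrite /= Ps'.
Qed.

(** * Displacements, and the existence of words for affine permutations *)

Definition disp (w : int -> int) (m : int) : int := w m - m.

Lemma sum_window (V : zmodType) (f : int -> V) :
  (forall m, f (m + n) = f m) ->
  \sum_(1 <= m < k.+2) f m%:Z = \sum_(i < k.+1) f i%:Z.
Proof.
move=> Pf; rewrite -(big_mkord xpredT (fun i => f i%:Z)).
rewrite big_nat_recr //= [RHS]big_nat_recl //= big_add1 /= addrC.
by congr (_ + _); rewrite -[in RHS](Pf 0) add0r.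
Qed.

Lemma disp_periodic w : periodic w -> forall m, disp w (m + n) = disp w m.
Proof. by move=> Pw m; rewrite /disp Pw; lia. Qed.

(** [ordS] wraps k around to 0 while r + 1 does not; a function of period n does not see the
    difference. *)
Lemma ordS_periodic (V : Type) (f : int -> V) (r : 'I_k.+1) :
  (forall m, f (m + n) = f m) -> f (ordS r)%:Z = f (r%:Z + 1).
Proof.
move=> Pf; rewrite /=; have := ltn_ord r; rewrite leq_eqVlt => /orP[/eqP Er|lr].
  by rewrite Er modnn -(Pf 0); congr f; lia.
by rewrite modn_small //; congr f; lia.
Qed.

Lemma ordS_neq (r : 'I_k.+1) : ordS r != r.
Proof.
apply/eqP => /(congr1 val) /=; have := ltn_ord r.
rewrite leq_eqVlt => /orP[/eqP Er|lr]; first by rewrite Er modnn; lia.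
by rewrite modn_small //; lia.
Qed.

Lemma ord_eqmod (i r : 'I_k.+1) : (i%:Z == r%:Z %[mod n])%Z -> i = r.
Proof.
move=> /eqP; rewrite !modz_small; try by have := ltn_ord i; have := ltn_ord r; lia.
by case=> /ord_inj.
Qed.

Lemma ordS_eqmod (i r : 'I_k.+1) :
  (i%:Z == r%:Z + 1 %[mod n])%Z -> i = ordS r.
Proof.
move=> H; apply: ord_eqmod.
by rewrite (@ordS_periodic _ (fun m => (m %% n)%Z)) // => m; rewrite modzDr.
Qed.

(** Within one period only two displacements change: they trade places and are shifted by 1 and -1.
    The identity as [G] gives the invariance of the sum condition, the square gives the energy drop
    in [affine_wordP]. *)
Lemma sum_disp_simple (G : int -> int) w (r : 'I_k.+1) :
  periodic w ->
  \sum_(i < k.+1) G (disp (w \o simple r) i%:Z) =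
  \sum_(i < k.+1) G (disp w i%:Z)
  + (G (disp w (r%:Z + 1) + 1) - G (disp w (r%:Z + 1)))
  + (G (disp w r%:Z - 1) - G (disp w r%:Z)).
Proof.
move=> Pw.
have Pd := disp_periodic Pw.
have Pd' := disp_periodic (periodic_comp Pw (simple_periodic r)).
rewrite (bigD1 r) // (bigD1 (ordS r)) ?ordS_neq //=.
rewrite [X in _ = X + _ + _](bigD1 r) // [X in _ = _ + X + _ + _](bigD1 (ordS r)) ?ordS_neq //=.
rewrite -![(r.+1 %% k.+1)%N]/(nat_of_ord (ordS r)).
rewrite (ordS_periodic (f := disp (w \o simple r))) // (ordS_periodic (f := disp w)) //.
have -> : disp (w \o simple r) r = disp w (r%:Z + 1) + 1.
  by rewrite /disp /= simpleE transpL; lia.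
have -> : disp (w \o simple r) (r%:Z + 1) = disp w r%:Z - 1.
  by rewrite /disp /= simpleE transpR ?neqmodS //; lia.
set S := \sum_(i < _ | _) _; set S' := \sum_(i < _ | _) _.
have -> : S' = S.
  apply: eq_bigr => i /andP[Ni Ni']; rewrite /disp /= simpleE transpN //.
    by apply: contra Ni => /ord_eqmod->.
  by apply: contra Ni' => /ordS_eqmod->.
by lia.
Qed.

Lemma affine_sumE w : periodic w ->
  \sum_(1 <= m < k.+2) w m%:Z = \sum_(1 <= m < k.+2) m%:Z <->
  \sum_(i < k.+1) disp w i%:Z = 0.
Proof.
move=> Pw; rewrite -(sum_window (disp_periodic Pw)) sumrB.
split=> [->|/eqP]; first by rewrite subrr.
by rewrite subr_eq0 => /eqP.
Qed.

Lemma affine_perm_simple w (r : 'I_k.+1) :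
  affine_perm k w -> affine_perm k (w \o simple r).
Proof.
move=> [Bw Pw Sw]; have Pws := periodic_comp Pw (simple_periodic r).
split=> //.
  by apply: bij_comp => //; exists (simple r); apply: simpleK.
apply/(affine_sumE Pws); rewrite (sum_disp_simple id) // (affine_sumE Pw).1 //.
by lia.
Qed.

Lemma affine_word (s : seq 'I_k.+1) : affine_perm k (word_perm s).
Proof.
elim/last_ind: s => [|s r IH]; first by split=> //; exists id.
by rewrite word_perm_rcons; apply: affine_perm_simple.
Qed.

(** A nondecreasing periodic function is constant. *)
Lemma disp_const w : periodic w -> (forall m, disp w m <= disp w (m + 1)) ->
  forall m, disp w m = disp w 0.
Proof.
move=> Pw le_disp.
have le_nat m (i : nat) : disp w m <= disp w (m + i%:Z).
  elim: i => [|i IH]; first by rewrite addr0.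
  by apply: le_trans IH _; rewrite -addn1 PoszD addrA.
have eq_nat m (i : nat) : (i <= k.+1)%N -> disp w (m + i%:Z) = disp w m.
  move=> le_ik; apply/eqP; rewrite eq_le le_nat andbT.
  apply: le_trans (le_nat _ (k.+1 - i)%N) _.
  have -> : m + i%:Z + (k.+1 - i)%N%:Z = m + n by lia.
  by rewrite disp_periodic.
have eqS m : disp w (m + 1) = disp w m by rewrite -(eq_nat m 1%N).
elim/int_ind => [//|i IH|i IH]; first by rewrite -addn1 PoszD eqS.
by rewrite -eqS -IH; congr disp; lia.
Qed.

(** Injectivity makes w r <= w (r + 1) strict, which for integers says that the displacement does
    not decrease; periodicity extends this from r in 0..k to all m. *)
Lemma disp_descent w : periodic w ->
  (forall r : 'I_k.+1, w r%:Z <= w (r%:Z + 1)) -> injective w ->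
  forall m, disp w m <= disp w (m + 1).
Proof.
move=> Pw le_w Iw m; have mz : 0 <= (m %% n)%Z < n by rewrite modz_ge0 // ltz_pmod.
have lt_r : (absz (m %% n)%Z < k.+1)%N by lia.
have le_m : w (m %% n)%Z <= w ((m %% n)%Z + 1).
  by have := le_w (Ordinal lt_r); rewrite /= gez0_abs; lia.
have Nw : w (m %% n)%Z <> w ((m %% n)%Z + 1) by move/Iw; lia.
have wM := periodicM Pw (m %/ n)%Z.
have Em : m = (m %% n)%Z + (m %/ n)%Z * n by rewrite addrC -divz_eq.
have wm := wM (m %% n)%Z; rewrite -Em in wm.
have wm1 := wM ((m %% n)%Z + 1); rewrite addrAC -Em in wm1.
by rewrite /disp wm wm1; lia.
Qed.

(* The displacement energy drops by 2 (w r - w (r + 1)) when a descent r of w is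
   undone. *)
Lemma affine_wordP w :
  affine_perm k w -> exists s : seq 'I_k.+1, word_perm s = w.
Proof.
pose E w : int := \sum_(i < k.+1) disp w i%:Z * disp w i%:Z.
have E_ge0 v : 0 <= E v by apply: sumr_ge0 => i _; nia.
have [N leN] : exists N : nat, E w < N%:Z by exists (absz (E w)).+1; lia.
elim: N w leN => [|N IH] w ltN Aw; first by have := E_ge0 w; lia.
have [Bw Pw Sw] := Aw.
have [[r lt_r]|no_desc] := pselect (exists r : 'I_k.+1, w (r%:Z + 1) < w r%:Z).
  have [|s Es] := IH (w \o simple r) _ (affine_perm_simple r Aw).
    have := sum_disp_simple (fun x => x * x) r Pw; rewrite -/(E _) -/(E w).
    by rewrite /disp; nia.
  exists (rcons s r); rewrite word_perm_rcons Es; apply/funext => m /=.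
  by rewrite simpleK.
have le_w (r : 'I_k.+1) : w r%:Z <= w (r%:Z + 1).
  by rewrite leNgt; apply/negP => lt_r; apply: no_desc; exists r.
(* Without descents the displacement is constant, and the sum condition forces the constant to be 0,
   so w is the identity. *)
have Dw := disp_const Pw (disp_descent Pw le_w (bij_inj Bw)).
have : disp w 0 = 0.
  have := (affine_sumE Pw).1 Sw; rewrite (eq_bigr (fun=> disp w 0)) //.
  by rewrite sumr_const card_ord => /eqP; rewrite mulrn_eq0 /= => /eqP.
move=> D0; exists [::]; apply/funext => m /=.
by have := Dw m; rewrite D0 /disp; lia.
Qed.

(** A shortest word exists by well-ordering, so on affine permutations [reduced_word] does not fall
    back on its default value. *)
Lemma reduced_wordP w : affine_perm k w -> is_reduced_word w (reduced_word k w).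
Proof.
case/affine_wordP => s Es.
have exm : exists m, `[< exists2 s' : seq 'I_k.+1, word_perm s' = w & size s' = m >].
  by exists (size s); apply/asboolP; exists s.
case: (ex_minnP exm) => m /asboolP[s0 Es0 <-] minm.
rewrite /reduced_word; apply: (@xgetPex _ [::] [set s | is_reduced_word w s]).
exists s0; split=> // s' Es'.
by apply: minm; apply/asboolP; exists s'.
Qed.

Lemma coxeter_length_word (s : seq 'I_k.+1) :
  (coxeter_length k (word_perm s) <= size s)%N.
Proof. by have [_] := reduced_wordP (affine_word s); apply. Qed.

(** The exchange property gives a word for the product, which spares a direct check of the sum
    condition. *)
Lemma affine_transp w p q :
  affine_perm k w -> w q < w p -> p < q -> affine_perm k (w \o tr p q).
Proof.
move=> /affine_wordP[s <-] lt_w lt_pq.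
by have [s' _ <-] := strong_exchange lt_pq lt_w; apply: affine_word.
Qed.

Lemma coxeter_length_transp w p q :
  affine_perm k w -> w q < w p -> p < q ->
  (coxeter_length k (w \o tr p q) < coxeter_length k w)%N.
Proof.
move=> Aw lt_w lt_pq; have [Es _] := reduced_wordP Aw.
have [s' size_s' Es'] : exists2 s' : seq 'I_k.+1,
    coxeter_length k w = (size s').+1 & word_perm s' = w \o tr p q.
  rewrite /coxeter_length -[in w \o _]Es.
  by apply: strong_exchange => //; rewrite Es.
by rewrite size_s' ltnS -Es' coxeter_length_word.
Qed.

Lemma coxeter_length_simple w (r : 'I_k.+1) : affine_perm k w ->
  (coxeter_length k (w \o simple r) <= (coxeter_length k w).+1)%N.
Proof.
move=> Aw; have [Es _] := reduced_wordP Aw.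
rewrite -[in w \o _]Es -word_perm_rcons.
by apply: leq_trans (coxeter_length_word _) _; rewrite size_rcons.
Qed.

Lemma comp_simpleK (w : int -> int) (r : 'I_k.+1) : (w \o simple r) \o simple r = w.
Proof. by apply/funext => m /=; rewrite simpleK. Qed.

(** One letter changes the length by at most one, and the exchange property makes the change strict,
    applied to w at a descent and to [w \o simple r] otherwise. In the second branch [.-1] is a true
    predecessor, as [w \o simple r] is then longer than w. *)
Lemma coxeter_length_descent w (r : 'I_k.+1) : affine_perm k w ->
  coxeter_length k w =
  if w (r%:Z + 1) < w r%:Z then (coxeter_length k (w \o simple r)).+1
  else (coxeter_length k (w \o simple r)).-1.
Proof.
move=> Aw; have Aws := affine_perm_simple r Aw.
have := coxeter_length_simple r Aw; have := coxeter_length_simple r Aws.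
rewrite comp_simpleK => le1 le2.
case: ltP => [lt_w|le_w].
  have := coxeter_length_transp Aw lt_w _; rewrite -simpleE => /(_ ltac:(lia)).
  by lia.
have [Bw _ _] := Aw.
have Nw : w r%:Z <> w (r%:Z + 1) by move/(bij_inj Bw); lia.
have lt_w : (w \o simple r) (r%:Z + 1) < (w \o simple r) r%:Z.
  by rewrite /= simpleE transpL transpR ?neqmodS //; lia.
have := coxeter_length_transp Aws lt_w _; rewrite -simpleE comp_simpleK.
by move=> /(_ ltac:(lia)); lia.
Qed.

Lemma simple_ordS (r : 'I_k.+1) : simple (ordS r) = tr (r%:Z + 1) (r%:Z + 1 + 1).
Proof.
rewrite simpleE (ordS_periodic (f := fun m => tr m (m + 1))) // => m.
by rewrite addrAC -[n]mul1r transp_shift.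
Qed.

Lemma descent_ordS (w : int -> int) (r : 'I_k.+1) : periodic w ->
  (w ((ordS r)%:Z + 1) < w (ordS r)%:Z) = (w (r%:Z + 1 + 1) < w (r%:Z + 1)).
Proof.
move=> Pw; rewrite (ordS_periodic (f := fun m => w (m + 1) < w m)) // => m.
by rewrite addrAC !Pw ltrD2r.
Qed.

Lemma neqmod2 (i : int) : (1 < k)%N -> (i != i + 1 + 1 %[mod n])%Z.
Proof. by move=> k_gt1; apply: neqmod_lt; lia. Qed.

(** For k = 1 two consecutive descents would contradict w (z + 2) = w z + 2. This supplies the
    condition [1 < k] of the braid relation. *)
Lemma double_descent (w : int -> int) (z : int) : periodic w ->
  w (z + 1 + 1) < w (z + 1) -> w (z + 1) < w z -> (1 < k)%N.
Proof.
move=> Pw d1 d2; rewrite ltnNge; apply/negP => le_k; have := Pw z.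
have -> : z + n = z + 1 + 1 by lia.
by lia.
Qed.

Lemma simple_far (a b : 'I_k.+1) : a != b -> b != ordS a -> a != ordS b ->
  simple a b%:Z = b%:Z /\ simple a (b%:Z + 1) = b%:Z + 1.
Proof.
move=> Nab Nb Na; rewrite simpleE; split; apply: transpN.
- by apply: contra Nab => /ord_eqmod->.
- by apply: contra Nb => /ordS_eqmod->.
- by apply: contra Na; rewrite eq_sym => /ordS_eqmod->.
- rewrite -(ordS_periodic (f := fun m => (m %% n)%Z)); last by move=> m; rewrite modzDr.
  rewrite -(ordS_periodic (f := fun m => (m %% n)%Z)); last by move=> m; rewrite modzDr.
  by apply: contra Nab => /ord_eqmod/ordS_inj->.
Qed.

Lemma simple_comm (a b : 'I_k.+1) : b != ordS a -> a != ordS b ->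
  simple a \o simple b = simple b \o simple a.
Proof.
have [->//|Nab Nb Na] := eqVneq a b.
have [Eb Eb1] := simple_far Nab Nb Na.
rewrite [simple b]simpleE transp_conj ?Eb ?Eb1 //.
  exact: simple_periodic.
exact/inv_inj/simpleK.
Qed.

(** Both sides are the reflection [tr a (a + 1 + 1)]; for [1 < k] the three positions involved lie
    in distinct classes. *)
Lemma simple_braid (a : 'I_k.+1) : (1 < k)%N ->
  simple a \o simple (ordS a) \o simple a =
  simple (ordS a) \o simple a \o simple (ordS a).
Proof.
move=> k_gt1.
have -> : simple a \o simple (ordS a) = tr a%:Z (a%:Z + 1 + 1) \o simple a.
  rewrite simple_ordS transp_conj; last 2 first.
  - exact: simple_periodic.
  - exact/inv_inj/simpleK.
  rewrite simpleE transpR ?neqmodS // transpN //.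
    by rewrite eq_sym; apply: neqmod_lt; lia.
  by rewrite eq_sym; apply: neqmod_lt; lia.
have -> : simple (ordS a) \o simple a =
    tr a%:Z (a%:Z + 1 + 1) \o simple (ordS a).
  rewrite [simple a]simpleE transp_conj; last 2 first.
  - exact: simple_periodic.
  - exact/inv_inj/simpleK.
  rewrite simple_ordS transpL transpN //.
    by apply: neqmod_lt; lia.
  by apply: neqmod_lt; lia.
by apply/funext => m /=; rewrite !simpleK.
Qed.

Definition reduced (s : seq 'I_k.+1) : bool :=
  size s == coxeter_length k (word_perm s).

Lemma reduced_word_reduced w : affine_perm k w ->
  word_perm (reduced_word k w) = w /\ reduced (reduced_word k w).
Proof.
move=> Aw; have [Es _] := reduced_wordP Aw.
by rewrite /reduced Es eqxx.
Qed.

Lemma reduced_rcons (s : seq 'I_k.+1) a :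
  reduced (rcons s a) =
  reduced s && (word_perm s a%:Z < word_perm s (a%:Z + 1)).
Proof.
have As := affine_word s; have Aw := affine_word (rcons s a).
have le1 := coxeter_length_word s; have [Bs _ _] := As.
have Ns : word_perm s a%:Z <> word_perm s (a%:Z + 1) by move/(bij_inj Bs); lia.
have := coxeter_length_descent a Aw; rewrite /reduced size_rcons.
rewrite word_perm_rcons comp_simpleK //= simpleE transpL transpR ?neqmodS //.
case: ltP => Hlt Hl; rewrite ?andbT ?andbF; first by apply/eqP/eqP; lia.
by apply/eqP; lia.
Qed.

Lemma reduced_rcons_descent (v : seq 'I_k.+1) (x : int -> int) (c : 'I_k.+1) :
  x (c%:Z + 1) < x c%:Z -> reduced v -> word_perm v = x \o simple c ->
  reduced (rcons v c) /\ word_perm (rcons v c) = x.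
Proof.
move=> dc rv Ev; rewrite reduced_rcons rv word_perm_rcons Ev comp_simpleK.
by rewrite /= simpleE transpL transpR ?neqmodS.
Qed.

(** * Matsumoto's theorem, for any family [g] satisfying the commutation and braid relations *)

Section Matsumoto.

Variables (A : pzRingType) (g : 'I_k.+1 -> A).
Hypothesis g_comm : forall a b, b != ordS a -> a != ordS b ->
  g a * g b = g b * g a.
Hypothesis g_braid : forall a, (1 < k)%N ->
  g a * g (ordS a) * g a = g (ordS a) * g a * g (ordS a).

Local Notation P s := (\prod_(r <- s) g r).

Lemma prod_rcons (s : seq 'I_k.+1) a : P (rcons s a) = P s * g a.
Proof. by rewrite -cats1 big_cat big_seq1. Qed.

Lemma prod_rcons_comm (t : seq 'I_k.+1) a b : b != ordS a -> a != ordS b ->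
  P (rcons t b) * g a = P (rcons t a) * g b.
Proof.
by move=> Nb Na; rewrite !prod_rcons -!mulrA; rewrite (g_comm Nb Na).
Qed.

Lemma prod_rcons_braid (t : seq 'I_k.+1) a : (1 < k)%N ->
  P (rcons (rcons t a) (ordS a)) * g a =
  P (rcons (rcons t (ordS a)) a) * g (ordS a).
Proof.
move=> k_gt1; rewrite !prod_rcons -!mulrA.
by rewrite [g a * _]mulrA (g_braid _ k_gt1) !mulrA.
Qed.

(** Induction on the length. If the last letters a and b differ, both are descents of w, so w also
    has two reduced words that share a prefix and end in the two sides of the relation between a and
    b. The induction hypothesis links each given word to the one with the same last letter. *)
Lemma prod_reduced_eq (s s' : seq 'I_k.+1) :
  reduced s -> reduced s' -> word_perm s = word_perm s' ->
  P s = P s'.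
Proof.
have [N leN] := ubnP (size s); elim: N s s' leN => // N IH s s' leN rs rs' Ew.
have size_ss' : size s = size s' by rewrite (eqP rs) (eqP rs') Ew.
case/lastP: s leN rs Ew size_ss' => [|u a] leN rs Ew.
  by case: s' rs' Ew => [|? ?].
case/lastP: s' rs' Ew => [|u' b] rs' Ew; rewrite !size_rcons // => -[size_uu'].
have [ru da] := andP (etrans (esym (reduced_rcons u a)) rs).
have [ru' db] := andP (etrans (esym (reduced_rcons u' b)) rs').
rewrite !prod_rcons.
rewrite size_rcons ltnS in leN.
pose w := word_perm (rcons u a).
have Aw : affine_perm k w by apply: affine_word.
have [Bw Pw _] := Aw.
have Eu : word_perm u = w \o simple a by rewrite /w word_perm_rcons comp_simpleK.
have Eu' : word_perm u' = w \o simple b.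
  by rewrite /w Ew word_perm_rcons comp_simpleK.
have {}da : w (a%:Z + 1) < w a%:Z.
  by move: da; rewrite Eu /= simpleE transpL transpR ?neqmodS.
have {}db : w (b%:Z + 1) < w b%:Z.
  by move: db; rewrite Eu' /= simpleE transpL transpR ?neqmodS.
have lt_u' : (size u' < N)%N by rewrite -size_uu'.
have [Eab|Nab] := eqVneq a b.
  have -> : P u = P u'.
    by apply: IH leN ru ru' _; rewrite Eu Eu' Eab.
  by rewrite Eab.
(* Commuting letters: for a reduced word t of w s_a s_b, the words t b a and t a b are both reduced
   words of w. *)
have far : b != ordS a -> a != ordS b ->
    P u * g a = P u' * g b.
  move=> Nb Na.
  have [Eb Eb1] := simple_far Nab Nb Na.
  rewrite eq_sym in Nab; have [Ea Ea1] := simple_far Nab Na Nb.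
  have Awab := affine_perm_simple b (affine_perm_simple a Aw).
  have [] := reduced_word_reduced Awab; move: (reduced_word _ _) => t Et rt.
  have [|rtb Etb] := reduced_rcons_descent _ rt Et; first by rewrite /= Eb Eb1.
  have [||rta Eta] := @reduced_rcons_descent t (w \o simple b) a _ rt _.
  - by rewrite /= Ea Ea1.
  - rewrite Et; exact (f_equal (comp w) (simple_comm Nb Na)).
  have -> : P u = P (rcons t b).
    by apply: IH leN ru rtb _; rewrite Etb.
  have -> : P u' = P (rcons t a).
    by apply: IH lt_u' ru' rta _; rewrite Eta.
  exact: prod_rcons_comm.
(* Adjacent letters, stated for c and [ordS c] to serve both orders of a and b. With t a reduced
   word of w s_c s_(c+1) s_c, both braid words appended to t give reduced words of w. *)
have near (c d : 'I_k.+1) (x y : seq 'I_k.+1) : d = ordS c ->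
    w (c%:Z + 1) < w c%:Z -> w (d%:Z + 1) < w d%:Z ->
    (size x < N)%N -> (size y < N)%N -> reduced x -> reduced y ->
    word_perm x = w \o simple c -> word_perm y = w \o simple d ->
    P x * g c = P y * g d.
  move=> -> dc; rewrite descent_ordS // => dd ltx lty rx ry Ex Ey.
  have k_gt1 := double_descent Pw dd dc.
  have c2 : simple c (c%:Z + 1 + 1) = c%:Z + 1 + 1.
    by rewrite simpleE transpN // eq_sym ?neqmod2 ?neqmodS.
  have d0 : simple (ordS c) c%:Z = c%:Z.
    by rewrite simple_ordS transpN ?neqmod2 ?neqmodS.
  have [c0 c1] : simple c c%:Z = c%:Z + 1 /\ simple c (c%:Z + 1) = c%:Z.
    by rewrite simpleE transpL transpR ?neqmodS.
  have [d1 d2] : simple (ordS c) (c%:Z + 1) = c%:Z + 1 + 1 /\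
      simple (ordS c) (c%:Z + 1 + 1) = c%:Z + 1.
    by rewrite simple_ordS transpL transpR ?neqmodS.
  have Awc := affine_perm_simple c Aw; have Awd := affine_perm_simple (ordS c) Aw.
  have Awcd := affine_perm_simple (ordS c) Awc.
  have Awdc := affine_perm_simple c Awd.
  have [_ Pwc _] := Awc; have [_ Pwdc _] := Awdc.
  have [] := reduced_word_reduced (affine_perm_simple c Awcd).
  move: (reduced_word _ _) => t Et rt.
  have [|r1 E1] := reduced_rcons_descent _ rt Et.
    by rewrite /= d0 d1 c0 c2.
  have [|r2 E2] := reduced_rcons_descent _ r1 E1.
    by rewrite descent_ordS //= c1 c2; apply: lt_trans dc.
  have [||r3 E3] := @reduced_rcons_descent t ((w \o simple (ordS c)) \o simple c) (ordS c) _ rt _.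
  - by rewrite descent_ordS //= c1 c2 d0 d2.
  - rewrite Et; exact (f_equal (comp w) (simple_braid c k_gt1)).
  have [|r4 E4] := reduced_rcons_descent _ r3 E3.
    by rewrite /= d0 d1; apply: lt_trans dc.
  rewrite (IH x _ ltx rx r2 (etrans Ex (esym E2))).
  rewrite (IH y _ lty ry r4 (etrans Ey (esym E4))).
  exact: prod_rcons_braid.
have [Eb|Nb] := eqVneq b (ordS a).
  exact: near Eb da db leN lt_u' ru ru' Eu Eu'.
have [Ea|Na] := eqVneq a (ordS b); last exact: far.
exact/esym/(near _ _ _ _ Ea db da lt_u' leN ru' ru Eu' Eu).
Qed.

End Matsumoto.

(** * Products of generators in the nilCoxeter algebra *)

Section NilCoxeterWords.

Variable R : comNzRingType.

Lemma nc_relE (x y : {malg R[{fmonom 'I_k.+1}]}) :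
  nilCoxeter_rel (x - y) -> nilCoxeter_pi x = nilCoxeter_pi y.
Proof.
by move=> rel_xy; apply/nilCoxeter_piP/nilCoxeter_idealP => J _; apply.
Qed.

Lemma nc_piM (x y : {malg R[{fmonom 'I_k.+1}]}) :
  nilCoxeter_pi x * nilCoxeter_pi y = nilCoxeter_pi (x * y).
Proof. exact/esym/nilCoxeter_piM. Qed.

Lemma nc_gen_comm (a b : 'I_k.+1) : b != ordS a -> a != ordS b ->
  nc_gen R a * nc_gen R b = nc_gen R b * nc_gen R a.
Proof.
move=> Nb Na.
have rel_ab := nc_relE (Or33 _ _ (ex_intro _ a (ex_intro _ b (And3 Nb Na erefl)))).
exact: etrans (nc_piM _ _) (etrans rel_ab (esym (nc_piM _ _))).
Qed.

Lemma nc_piM3 (x y z : {malg R[{fmonom 'I_k.+1}]}) :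
  nilCoxeter_pi x * nilCoxeter_pi y * nilCoxeter_pi z =
  nilCoxeter_pi (x * y * z).
Proof.
refine (etrans _ (nc_piM (x * y) z)).
exact (f_equal (fun t : nilCoxeter R k => t * nilCoxeter_pi z) (nc_piM x y)).
Qed.

Lemma nc_gen_braid (a : 'I_k.+1) : (1 < k)%N ->
  nc_gen R a * nc_gen R (ordS a) * nc_gen R a =
  nc_gen R (ordS a) * nc_gen R a * nc_gen R (ordS a).
Proof.
move=> k_gt1.
have rel_a := nc_relE (Or32 _ _ (conj k_gt1 (ex_intro _ a erefl))).
exact: etrans (nc_piM3 _ _ _) (etrans rel_a (esym (nc_piM3 _ _ _))).
Qed.

Lemma nc_word_reduced_eq (s s' : seq 'I_k.+1) :
  reduced s -> reduced s' -> word_perm s = word_perm s' ->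
  nc_word R s = nc_word R s'.
Proof. exact: prod_reduced_eq nc_gen_comm nc_gen_braid s s'. Qed.

Lemma nc_basis_reduced (s : seq 'I_k.+1) :
  reduced s -> nc_basis R k (word_perm s) = nc_word R s.
Proof.
move=> rs; have [Es r0] := reduced_word_reduced (affine_word s).
exact: nc_word_reduced_eq.
Qed.

End NilCoxeterWords.
(** * Existence of the down operator *)

Section DownOperator.

Variable R : comNzRingType.

Local Notation FA := {malg R[{fmonom 'I_k.+1}]}.

Lemma malg_linear_ext (K : choiceType) (V : lmodType R) (h : K -> V) :
  exists F : {linear {malg R[K]} -> V}, forall c m, F << c *g m >> = c *: h m.
Proof.
pose f (g : {malg R[K]}) := \sum_(m <- msupp g) g@_m *: h m.
(* Sums over different supports become comparable on a common finite set containing them. *)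
have fE (d : {fset K}) g : (msupp g `<=` d)%fset ->
    f g = \sum_(m <- d) g@_m *: h m.
  move=> le_d; rewrite [LHS](big_fset_incl _ le_d) //= => x _ /mcoeff_outdom ->.
  by rewrite scale0r.
have f_lin : linear f.
  move=> a g1 g2; pose d := (msupp g1 `|` msupp g2)%fset.
  have d1 : (msupp g1 `<=` d)%fset by apply: fsubsetUl.
  have d2 : (msupp g2 `<=` d)%fset by apply: fsubsetUr.
  have d12 : (msupp (a *: g1 + g2) `<=` d)%fset.
    apply: fsubset_trans (msuppD_le _ _) _; apply: fsetUSS => //.
    exact: msuppZ_le.
  rewrite (fE d) // (fE d g1) // (fE d g2) // scaler_sumr -big_split /=.
  by apply: eq_bigr => m _; rewrite mcoeffD mcoeffZ scalerDl scalerA.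
pose fL := GRing.isLinear.Build R {malg R[K]} V *:%R f f_lin.
pose F : {linear {malg R[K]} -> V} := HB.pack f fL.
exists F => c m; rewrite [LHS](fE [fset m]%fset); last exact: msuppU_le.
by rewrite big_seq_fset1 mcoeffUU.
Qed.

Definition monom (s : seq 'I_k.+1) : {fmonom 'I_k.+1} := FMonom s.

Lemma monomM s t : mmul (monom s) (monom t) = monom (s ++ t).
Proof. by apply: val_inj; rewrite /= fmM. Qed.

Lemma malgUM (m1 m2 : {fmonom 'I_k.+1}) :
  << m1 >> * << m2 >> = << mmul m1 m2 >> :> FA.
Proof. by rewrite malgM_def fgmulUU mul1r. Qed.

Lemma free_genE (r : 'I_k.+1) : free_gen R r = << monom [:: r] >>.
Proof. by rewrite /free_gen fmuE. Qed.

Lemma free_gen2 (r q : 'I_k.+1) :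
  free_gen R r * free_gen R q = << monom [:: r; q] >>.
Proof. by rewrite !free_genE malgUM monomM. Qed.

Lemma free_gen3 (r q p : 'I_k.+1) :
  free_gen R r * free_gen R q * free_gen R p = << monom [:: r; q; p] >>.
Proof. by rewrite free_gen2 free_genE malgUM monomM. Qed.

Lemma malgU_ind (P : FA -> Prop) :
  P 0 -> (forall x y, P x -> P y -> P (x + y)) ->
  (forall c s, P (c *: << monom s >>)) -> forall x, P x.
Proof.
move=> P0 PD PU x; rewrite [x]monalgE; elim/big_ind: _ => // m _.
have -> : << x@_m *g m >> = x@_m *: << monom m >> :> FA.
  apply/malgP => m'; rewrite mcoeffZ !mcoeffU.
  have -> : monom m = m by case: (m).
  by rewrite mulr_natr.
exact: PU.
Qed.

Lemma nc_wordE (s : seq 'I_k.+1) : nc_word R s = nilCoxeter_pi (<< monom s >> : FA).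
Proof.
elim: s => [|r s IH].
  rewrite /nc_word big_nil.
  suff -> : << monom [::] >> = 1 :> FA by [].
  by congr << _ >>; apply: val_inj; rewrite /= fm1.
rewrite /nc_word big_cons -/(nc_word R s) IH.
refine (etrans (nc_piM _ _) _); congr nilCoxeter_pi.
by rewrite free_genE malgUM monomM.
Qed.

Section LinearExtension.

Variables (V : lmodType R) (h : seq 'I_k.+1 -> V).
Hypothesis h_nil : forall u v r, h (u ++ [:: r; r] ++ v) = 0.
Hypothesis h_braid : forall u v r, (1 < k)%N ->
  h (u ++ [:: r; ordS r; r] ++ v) = h (u ++ [:: ordS r; r; ordS r] ++ v).
Hypothesis h_comm : forall u v r q, q != ordS r -> r != ordS q ->
  h (u ++ [:: r; q] ++ v) = h (u ++ [:: q; r] ++ v).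

(** The kernel of a linear map need not be an ideal, but the y such that F (a y b) = 0 for all a and
    b form one. It contains the relations by the hypotheses on [h], hence the whole nilCoxeter
    ideal. *)
Lemma ideal_linear_ext (F : {linear FA -> V}) :
  (forall c m, F << c *g m >> = c *: h m) ->
  forall x, x \in @nilCoxeter_ideal R k -> F x = 0.
Proof.
move=> FE x /nilCoxeter_idealP.
(* By bilinearity it suffices to take monomials for a and b. *)
have FM (y : FA) : (forall s t, F (<< monom s >> * y * << monom t >>) = 0) ->
    forall a b, F (a * y * b) = 0.
  move=> Fy; elim/malgU_ind => [b|a1 a2 IH1 IH2 b|c s].
  - by rewrite !mul0r raddf0.
  - rewrite (mulrDl a1) (mulrDl (a1 * y)) (raddfD F).
    by rewrite [X in X + _](IH1 b) [X in _ + X](IH2 b) addr0.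
  elim/malgU_ind => [|b1 b2 IH1 IH2|d t]; first by rewrite mulr0 raddf0.
    rewrite (mulrDr (_ * y) b1) (raddfD F).
    by rewrite [X in X + _]IH1 [X in _ + X]IH2 addr0.
  by rewrite -free_scaleAr -!scalerAl !linearZ /= Fy !scaler0.
move=> /(_ (fun y : FA => forall a b, F (a * y * b) = 0)) H.
rewrite -[x]mulr1 -[x]mul1r; apply: H => [|{}x].
  split=> [a b|y z Fy Fz a b|a' y Fy a b|a' y Fy a b].
  - by rewrite mulr0 mul0r raddf0.
  - by rewrite (mulrBr a y) (mulrBl b (a * y)) (raddfB F) [X in X - _]Fy [X in _ - X]Fz subr0.
  - by rewrite (mulrA a).
  - by rewrite (mulrA a) -(mulrA (a * y)).
have FU s m t : F (<< monom s >> * << monom m >> * << monom t >>) = h (s ++ m ++ t).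
  by rewrite malgUM monomM malgUM monomM FE scale1r -catA.
have FB s m m' t : h (s ++ m ++ t) = h (s ++ m' ++ t) ->
    F (<< monom s >> * (<< monom m >> - << monom m' >>) * << monom t >>) = 0.
  move=> Eh; rewrite (mulrBr << monom s >>) (mulrBl << monom t >>) (raddfB F).
  by rewrite [X in X - _]FU [X in _ - X]FU Eh subrr.
move=> Hx; apply: FM => s t.
case: Hx => [[r Ex]|[k_gt1 [r Ex]]|[r [q [Nq Nr Ex]]]].
- by rewrite Ex free_gen2 FU; apply: h_nil.
- have {}Ex := etrans Ex (f_equal2 (fun a b : FA => a - b)
    (free_gen3 r (ordS r) r) (free_gen3 (ordS r) r (ordS r))).
  by rewrite Ex; apply/FB/h_braid.
- have {}Ex := etrans Ex (f_equal2 (fun a b : FA => a - b)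
    (free_gen2 r q) (free_gen2 q r)).
  by rewrite Ex; apply/FB/h_comm.
Qed.

Lemma nc_linear_ext :
  exists D : {linear nilCoxeter R k -> V}, forall s, D (nc_word R s) = h s.
Proof.
have [F FE] := malg_linear_ext (fun m : {fmonom 'I_k.+1} => h m).
(* F vanishes on the ideal, so its value does not depend on the representative. *)
pose f (x : nilCoxeter R k) : V := F (repr x).
have fpi (x : FA) : f (nilCoxeter_pi x) = F x.
  apply/eqP; rewrite -subr_eq0 -raddfB /=; apply/eqP.
  by apply: (ideal_linear_ext FE); apply: nilCoxeter_reprB.
have f_lin : linear f.
  move=> a x y; rewrite -[RHS]linearP -fpi nilCoxeter_piD; congr (f (_ + _)).
  exact (esym (nilCoxeter_piK y)).
pose fL := GRing.isLinear.Build R (nilCoxeter R k) V *:%R f f_lin.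
pose D : {linear nilCoxeter R k -> V} := HB.pack f fL.
by exists D => s; rewrite nc_wordE [LHS]fpi FE scale1r.
Qed.

End LinearExtension.

Lemma reduced_cat_eq (u m m' v : seq 'I_k.+1) :
  size m = size m' -> word_perm m = word_perm m' ->
  word_perm (u ++ m ++ v) = word_perm (u ++ m' ++ v) /\
  reduced (u ++ m ++ v) = reduced (u ++ m' ++ v).
Proof.
move=> size_m Em.
have Ew : word_perm (u ++ m ++ v) = word_perm (u ++ m' ++ v).
  by rewrite !word_perm_cat Em.
by rewrite /reduced Ew !size_cat size_m.
Qed.

Lemma reduced_square (u v : seq 'I_k.+1) r :
  reduced (u ++ [:: r; r] ++ v) = false.
Proof.
have Ew : word_perm (u ++ [:: r; r] ++ v) = word_perm (u ++ v).
  by rewrite !word_perm_cat; apply/funext => z /=; rewrite simpleK.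
have := coxeter_length_word (u ++ v).
by rewrite /reduced Ew !size_cat /=; lia.
Qed.

(** Inside any word, the two sides of a braid or commutation relation have the same length and
    permutation, and a square prevents reducedness, so [h] respects the relations. With G the sum
    over strips this gives the down operator. *)
Lemma nc_basis_linear_ext (V : lmodType R) (G : (int -> int) -> V) :
  exists D : {linear nilCoxeter R k -> V},
    forall w, affine_perm k w -> D (nc_basis R k w) = G w.
Proof.
pose h (s : seq 'I_k.+1) := if reduced s then G (word_perm s) else 0.
have [u v r|u v r k_gt1|u v r q Nq Nr|D DE] := @nc_linear_ext V h.
- by rewrite /h reduced_square.
- have [] := @reduced_cat_eq u [:: r; ordS r; r] [:: ordS r; r; ordS r] v erefl.
    exact (simple_braid r k_gt1).
  by rewrite /h => -> ->.
- have [] := @reduced_cat_eq u [:: r; q] [:: q; r] v erefl.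
    exact (simple_comm Nq Nr).
  by rewrite /h => -> ->.
exists D => w /reduced_word_reduced[Ew rw].
by rewrite [LHS]DE /h rw Ew.
Qed.

Lemma down_operatorE m w : affine_perm k w ->
  down_operator R k m (nc_basis R k w) =
  (\sum_(p \in strong_strip k m w) nc_basis R k (strip_end w p))%R.
Proof.
move=> Aw; rewrite /down_operator; case: pselect => [exD|[]].
  case: (cid exD) => D DE; exact (DE w Aw).
exact: nc_basis_linear_ext.
Qed.

End DownOperator.
(** * Covers inside the window *)

Lemma comp_transpK (w : int -> int) i j :
  (i != j %[mod n])%Z -> (w \o tr i j) \o tr i j = w.
Proof. by move=> Nij; apply/funext => m /=; rewrite transpK. Qed.

Lemma transp_conj3 i m j : (i != m %[mod n])%Z -> (j != i %[mod n])%Z ->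
  (j != m %[mod n])%Z -> (tr i m \o tr m j) \o tr i m = tr i j.
Proof.
move=> Nim Nji Njm; rewrite (transp_conj (f := tr i m) m j); last 2 first.
- exact: transp_periodic.
- exact/inv_inj/transpK.
by rewrite transpR // (transpN Nji Njm) comp_transpK.
Qed.

Lemma coxeter_length_transpS w i : affine_perm k w ->
  (coxeter_length k (w \o tr i (i + 1)) <= (coxeter_length k w).+1)%N.
Proof. by rewrite -simple_res => /coxeter_length_simple. Qed.

Lemma affine_transpS w i : affine_perm k w -> affine_perm k (w \o tr i (i + 1)).
Proof. by rewrite -simple_res => /affine_perm_simple. Qed.

Lemma coxeter_length_desc w (i : int) : affine_perm k w -> w (i + 1) < w i ->
  coxeter_length k w = (coxeter_length k (w \o tr i (i + 1))).+1.
Proof.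
move=> Aw dw; apply/eqP; rewrite eqn_leq coxeter_length_transp //; last by lia.
have := coxeter_length_transpS i (affine_transpS i Aw).
by rewrite comp_transpK ?neqmodS // => ->.
Qed.

Lemma coxeter_length_asc w (i : int) : affine_perm k w -> w i < w (i + 1) ->
  coxeter_length k (w \o tr i (i + 1)) = (coxeter_length k w).+1.
Proof.
move=> Aw dw; rewrite (@coxeter_length_desc _ i); last 2 first.
- exact: affine_transpS.
- by rewrite /= transpL transpR ?neqmodS.
by rewrite comp_transpK ?neqmodS.
Qed.

(** An intermediate value at an intermediate position splits [tr i j] into three reflections, each
    of which undoes an inversion. *)
Lemma coxeter_length_between w (i m j : int) : affine_perm k w ->
  i < m -> m < j -> j < i + n -> w j < w m -> w m < w i ->
  (coxeter_length k (w \o tr i j) + 3 <= coxeter_length k w)%N.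
Proof.
move=> Aw lt_im lt_mj lt_jn wjm wmi.
have Nim : (i != m %[mod n])%Z by apply: neqmod_lt; lia.
have Nmj : (m != j %[mod n])%Z by apply: neqmod_lt; lia.
have Nij : (i != j %[mod n])%Z by apply: neqmod_lt; lia.
have Nji : (j != i %[mod n])%Z by rewrite eq_sym.
have Njm : (j != m %[mod n])%Z by rewrite eq_sym.
have Nmi : (m != i %[mod n])%Z by rewrite eq_sym.
have wij := lt_trans wjm wmi.
have l1 := coxeter_length_transp Aw wmi lt_im.
have A1 := affine_transp Aw wmi lt_im.
have w1 : (w \o tr i m) j < (w \o tr i m) m.
  by rewrite /= transpR // (transpN Nji Njm).
have l2 := coxeter_length_transp A1 w1 lt_mj.
have A2 := affine_transp A1 w1 lt_mj.
have w2 : ((w \o tr i m) \o tr m j) m < ((w \o tr i m) \o tr m j) i.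
  by rewrite /= transpL (transpN Nim Nij) (transpN Nji Njm) transpL.
have := coxeter_length_transp A2 w2 lt_im.
have -> : ((w \o tr i m) \o tr m j) \o tr i m = w \o tr i j.
  exact (f_equal (comp w) (transp_conj3 Nim Nji Njm)).
by move: l1 l2; clear; lia.
Qed.

(** Induction on the distance d + 1, conjugating [tr (i + 1) j] by [tr i (i + 1)]. If w (i + 1) < w
    j, the first adjacent step loses one and the last regains one; if w i < w (i + 1), the first
    gains one and the last loses at most one. The middle reflection is handled by induction. *)
Lemma coxeter_length_cover (d : nat) w (i j : int) : affine_perm k w ->
  j = i + d.+1%:Z -> j < i + n -> w j < w i ->
  (forall m, i < m < j -> w m < w j \/ w i < w m) ->
  (coxeter_length k w <= (coxeter_length k (w \o tr i j)).+1)%N.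
Proof.
elim: d w i => [|d IH] w i Aw Ej lt_jn wij cov.
  have -> : j = i + 1 by lia.
  by have := coxeter_length_transpS i (affine_transpS i Aw);
    rewrite comp_transpK ?neqmodS.
have Ni1 := neqmodS i.
have Nij : (i != j %[mod n])%Z by apply: neqmod_lt; lia.
have N1j : (i + 1 != j %[mod n])%Z by apply: neqmod_lt; lia.
have Nji : (j != i %[mod n])%Z by rewrite eq_sym.
have Nj1 : (j != i + 1 %[mod n])%Z by rewrite eq_sym.
have A1 := affine_transpS i Aw.
pose w1 := w \o tr i (i + 1).
have w1i : w1 i = w (i + 1) by rewrite /w1 /= transpL.
have w1i1 : w1 (i + 1) = w i by rewrite /w1 /= transpR.
have w1j : w1 j = w j by rewrite /w1 /= transpN.
have w1d : w1 j < w1 (i + 1) by rewrite w1i1 w1j.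
have lt1 : i + 1 < j by lia.
have A2 := affine_transp A1 w1d lt1.
have l2 : (coxeter_length k w1 <= (coxeter_length k (w1 \o tr (i + 1) j)).+1)%N.
  apply: IH => //; [by lia|by lia|move=> m Hm].
  rewrite w1i1 w1j /w1 /= transpN; [|rewrite eq_sym; apply: neqmod_lt; lia|
    rewrite eq_sym; apply: neqmod_lt; lia].
  by apply: cov; lia.
have El : w \o tr i j = (w1 \o tr (i + 1) j) \o tr i (i + 1).
  exact (f_equal (comp w) (esym (transp_conj3 Ni1 Nji Nj1))).
pose x := w1 \o tr (i + 1) j.
have xi : x i = w (i + 1) by rewrite /x /= (transpN Ni1 Nij).
have xi1 : x (i + 1) = w j by rewrite /x /= transpL.
have [lt_w|lt_w] := cov (i + 1) ltac:(lia); rewrite El.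
  have := coxeter_length_desc Aw (lt_trans lt_w wij).
  have := @coxeter_length_asc x i A2; rewrite xi xi1 => /(_ lt_w).
  by rewrite -/w1 -/x in l2 *; move: l2; clear; lia.
have := coxeter_length_asc Aw lt_w.
have := coxeter_length_transpS i (affine_transpS i A2).
rewrite comp_transpK // -/w1 -/x; move: l2; rewrite -/x; clear; lia.
Qed.

Section Window.

Variable c : nat.
Hypothesis le_ck : (c <= k)%N.

(** A full set of classes modulo n: the row positions 1 - a with 1 <= a <= k + 1 - c, followed by
    the column positions 1, ..., c. *)
Definition in_window (m : int) : bool := c%:Z - k%:Z <= m <= c%:Z.

Definition windowed (w : int -> int) := forall m, in_window m -> in_window (w m).

Lemma window_eqmod (i j : int) :
  in_window i -> in_window j -> i <> j -> (i != j %[mod n])%Z.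
Proof.
rewrite /in_window => Hi Hj Nij; case: (ltgtP i j) => // lt_ij.
  by apply: neqmod_lt; lia.
by rewrite eq_sym; apply: neqmod_lt; lia.
Qed.

Lemma windowP (m : int) : exists2 m0, in_window m0 & exists t, m = m0 + t * n.
Proof.
pose a : int := c%:Z - k%:Z.
exists (((m - a) %% n)%Z + a).
  have : 0 <= ((m - a) %% n)%Z < n by rewrite modz_ge0 // ltz_pmod.
  by rewrite /in_window /a; lia.
exists ((m - a) %/ n)%Z; have := divz_eq (m - a) n; lia.
Qed.

Lemma windowed_eq w w' : periodic w -> periodic w' ->
  (forall m, in_window m -> w m = w' m) -> w = w'.
Proof.
move=> Pw Pw' Eww'; apply/funext => m; have [m0 Hm0 [t ->]] := windowP m.
by rewrite (periodicM Pw) (periodicM Pw') Eww'.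
Qed.

(** Unless both are in the window, i <= 0 < j puts i in an earlier translate of the window than j,
    and w maps each translate to itself. *)
Lemma windowed_lt w (i j : int) : periodic w -> windowed w -> i <= 0 < j ->
  ~~ (in_window i && in_window j) -> w i < w j.
Proof.
move=> Pw Ww Hij; have [i0 Hi0 [s Ei]] := windowP i.
have [j0 Hj0 [t Ej]] := windowP j.
have [lt_st _|le_ts] := ltP s t.
  rewrite Ei Ej !(periodicM Pw).
  have := Ww _ Hi0; have := Ww _ Hj0; rewrite /in_window => H1 H2.
  have : 0 <= (t - s - 1) * n by apply: mulr_ge0; lia.
  by lia.
have s0 : s <= 0.
  rewrite leNgt; apply/negP => s0; have : 0 <= (s - 1) * n by apply: mulr_ge0; lia.
  by move: Hi0; rewrite /in_window; lia.
have t0 : 0 <= t.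
  rewrite leNgt; apply/negP => t0; have : (t + 1) * n <= 0 by apply: mulr_le0_ge0; lia.
  by move: Hj0; rewrite /in_window; lia.
have Es : s = 0 by lia.
have Et : t = 0 by lia.
by rewrite Ei Ej Es Et !mul0r !addr0 Hi0 Hj0.
Qed.

Lemma windowed_transp w i j :
  windowed w -> in_window i -> in_window j -> windowed (w \o tr i j).
Proof.
move=> Ww Hi Hj m Hm /=; apply: Ww.
have [->|Nim] := eqVneq m i; first by rewrite transpL.
have [->|Njm] := eqVneq m j.
  have [->|Nij] := eqVneq i j; first by rewrite transpL.
  by rewrite transpR //; apply: window_eqmod => //; apply/eqP.
by rewrite transpN //; apply: window_eqmod => //; apply/eqP.
Qed.

Definition covers (x : int -> int) (i j : int) : Prop :=
  [/\ in_window i, in_window j, x j < x i &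
      forall m, i < m < j -> x m < x j \/ x i < x m].

(** A loss of length needs an inversion, which by [windowed_lt] puts both positions in the window.
    An intermediate value would make the loss at least 3; without one, [coxeter_length_cover] bounds
    it by 1. *)
Lemma coversP x (i j : int) : affine_perm k x -> windowed x -> i <= 0 < j ->
  (i != j %[mod n])%Z ->
  affine_perm k (x \o tr i j) /\
    coxeter_length k x = (coxeter_length k (x \o tr i j)).+1 <-> covers x i j.
Proof.
move=> Ax Wx Hij Nij; have [Bx Px _] := Ax; have Ix := bij_inj Bx.
have lt_ij : i < j by lia.
split=> [[Ay El]|[Hi Hj xji cov]].
  have xji : x j < x i.
    rewrite ltNge; apply/negP => le_x.
    have yji : (x \o tr i j) j < (x \o tr i j) i.
      rewrite /= transpL transpR // lt_neqAle le_x andbT.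
      by apply/eqP => /Ix; lia.
    have := coxeter_length_transp Ay yji lt_ij.
    by rewrite comp_transpK // El ltnNge leqnSn.
  have /andP[Hi Hj] : in_window i && in_window j.
    apply/negPn/negP => /(windowed_lt Px Wx Hij) lt_x.
    by have := lt_trans lt_x xji; rewrite ltxx.
  split=> // m /andP[lt_im lt_mj].
  have [lt_mj'|lt_jm|/Ix Emj] := ltgtP (x m) (x j); [by left| |by lia].
  have [lt_mi|lt_im'|/Ix Emj] := ltgtP (x m) (x i); [|by right|by lia].
  have lt_jn : j < i + n by move: Hi Hj; rewrite /in_window; lia.
  have := coxeter_length_between Ax lt_im lt_mj lt_jn lt_jm lt_mi.
  by rewrite El; clear; lia.
split; first exact: affine_transp.
apply/eqP; rewrite eqn_leq coxeter_length_transp // andbT.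
apply: (@coxeter_length_cover (absz (j - i)).-1) => //; first by lia.
by move: Hi Hj; rewrite /in_window; lia.
Qed.

(** * Reading words *)

Definition cell_transp (y : nat * nat) : int -> int := tr (1 - y.1%:Z) y.2%:Z.

Definition in_rect (y : nat * nat) : bool :=
  (0 < y.1 <= k.+1 - c)%N && (0 < y.2 <= c)%N.

Lemma in_rect_window y : in_rect y ->
  [/\ in_window (1 - y.1%:Z), in_window y.2%:Z & 1 - y.1%:Z <= 0 < y.2%:Z].
Proof. by rewrite /in_rect /in_window => Hy; split; lia. Qed.

Lemma in_rect_neqmod y : in_rect y -> (1 - y.1%:Z != y.2%:Z %[mod n])%Z.
Proof.
by case/in_rect_window => H1 H2 H3; apply: window_eqmod => //; lia.
Qed.

(** Partition diagrams inside the rectangle, described as lower sets so that dropping the first cell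
    in reading order stays within the class. *)
Definition order_ideal (L : seq (nat * nat)) : Prop :=
  [/\ uniq L, {in L, forall y, in_rect y} &
      forall y z, y \in L -> (0 < z.1 <= y.1)%N -> (0 < z.2 <= y.2)%N ->
      z \in L].

(** On an order ideal, [row_count] and [col_count] are the parts of the partition and of its
    conjugate. *)
Definition row_count (L : seq (nat * nat)) (a : nat) : nat :=
  count (fun y : nat * nat => y.1 == a) L.

Definition col_count (L : seq (nat * nat)) (b : nat) : nat :=
  count (fun y : nat * nat => y.2 == b) L.

Lemma mem_row_count L a b : order_ideal L -> (0 < a)%N -> (0 < b)%N ->
  ((a, b) \in L) = (b <= row_count L a)%N.
Proof.
move=> [uL rL dL] a0 b0; rewrite /row_count -size_filter.
apply/idP/idP => [Lab|].
  rewrite -[b in (b <= _)%N](size_iota 1) -(size_map (pair a)).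
  apply: uniq_leq_size; first by rewrite map_inj_uniq ?iota_uniq // => ? ? [].
  move=> y /mapP[b']; rewrite mem_iota => Hb' ->; rewrite mem_filter /= eqxx /=.
  by apply: dL Lab _ _ => /=; lia.
apply: contraLR => NLab; rewrite -ltnNge.
rewrite -(prednK b0) ltnS.
apply: (@leq_trans (size (map (pair a) (iota 1 b.-1)))); last first.
  by rewrite size_map size_iota.
apply: uniq_leq_size; first exact: filter_uniq.
move=> [a' b']; rewrite mem_filter /= => /andP[/eqP-> Lab'].
apply: map_f; rewrite mem_iota add1n prednK //.
have := rL _ Lab'; rewrite /in_rect /= => /andP[_ /andP[-> _]] /=.
by rewrite ltnNge; apply: contra NLab => le_b; apply: dL Lab' _ _ => /=; lia.
Qed.

Lemma mem_col_count L a b : order_ideal L -> (0 < a)%N -> (0 < b)%N ->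
  ((a, b) \in L) = (a <= col_count L b)%N.
Proof.
move=> [uL rL dL] a0 b0; rewrite /col_count -size_filter.
apply/idP/idP => [Lab|].
  rewrite -[a in (a <= _)%N](size_iota 1) -(size_map (pair^~ b)).
  apply: uniq_leq_size; first by rewrite map_inj_uniq ?iota_uniq // => ? ? [].
  move=> y /mapP[a']; rewrite mem_iota => Ha' ->; rewrite mem_filter /= eqxx /=.
  by apply: dL Lab _ _ => /=; lia.
apply: contraLR => NLab; rewrite -ltnNge.
rewrite -(prednK a0) ltnS.
apply: (@leq_trans (size (map (pair^~ b) (iota 1 a.-1)))); last first.
  by rewrite size_map size_iota.
apply: uniq_leq_size; first exact: filter_uniq.
move=> [a' b']; rewrite mem_filter /= => /andP[/eqP-> Lab'].
apply/mapP; exists a' => //; rewrite mem_iota add1n prednK //.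
have := rL _ Lab'; rewrite /in_rect /= => /andP[/andP[-> _] _] /=.
by rewrite ltnNge; apply: contra NLab => le_a; apply: dL Lab' _ _ => /=; lia.
Qed.

(** The first cell read is the right end of the bottom row, so no other cell lies weakly below and
    to the right of it. *)
Lemma order_ideal_behead y L :
  sorted reading_le (y :: L) -> order_ideal (y :: L) -> order_ideal L.
Proof.
move=> /(order_path_min reading_le_trans)/allP yL [/= /andP[NyL uL] rL dL].
split=> // [z Lz|z t Lz Ht1 Ht2]; first by apply: rL; rewrite inE Lz orbT.
have: t \in y :: L by apply: dL Ht1 Ht2; rewrite inE Lz orbT.
rewrite inE => /orP[/eqP Et|//]; subst t.
suff Ey : y = z by rewrite Ey Lz in NyL.
have := yL _ Lz; case: y z Ht1 Ht2 {yL dL rL NyL Lz} => a b [a' b'] /=.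
by rewrite /reading_le /= => Ht1 Ht2 H; congr (_, _); lia.
Qed.

Lemma row_col_count_new y L : order_ideal (y :: L) -> order_ideal L ->
  row_count L y.1 = y.2.-1 /\ col_count L y.2 = y.1.-1.
Proof.
case: y => a b Iy IL; have [/= /andP[NL _] rL dL] := Iy.
have := rL (a, b); rewrite inE eqxx /in_rect /= => /(_ isT) Hab.
have [a0 b0] : (0 < a)%N /\ (0 < b)%N by lia.
have NLr := mem_row_count IL a0 b0; have NLc := mem_col_count IL a0 b0.
rewrite (negPf NL) in NLr NLc.
have mem_pred a' b' : (0 < a' <= a)%N -> (0 < b' <= b)%N ->
    (a', b') <> (a, b) -> (a', b') \in L.
  move=> Ha Hb Nab; have := dL (a, b) (a', b').
  by rewrite !inE eqxx /= => /(_ isT Ha Hb) /orP[/eqP|].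
split.
  have [b1|b1] := leqP b 1; first by lia.
  have := mem_row_count IL a0 (b := b.-1); rewrite mem_pred; [|lia|lia|].
    by move=> /(_ ltac:(lia)); lia.
  by case; lia.
have [a1|a1] := leqP a 1; first by lia.
have := mem_col_count IL (a := a.-1) _ b0; rewrite mem_pred; [|lia|lia|].
  by move=> /(_ ltac:(lia)); lia.
by case; lia.
Qed.

Definition cells_word (L : seq (nat * nat)) : seq 'I_k.+1 :=
  [seq residue k y | y <- L].

Local Notation wp L := (word_perm (cells_word L)).

Lemma residueE y : residue k y = res (y.2%:Z - y.1%:Z).
Proof. by []. Qed.

(** Before the cell y is added, its row and column positions carry the consecutive values y.2 - y.1
    and y.2 - y.1 + 1. The new letter exchanges these values, which is the same as exchanging the
    two positions, and updates one row length and one column height. *)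
Lemma cells_word_spec L : sorted reading_le L -> order_ideal L ->
  [/\ forall a, (0 < a <= k.+1 - c)%N -> wp L (1 - a%:Z) = 1 - a%:Z + (row_count L a)%:Z,
      forall b, (0 < b <= c)%N -> wp L b%:Z = b%:Z - (col_count L b)%:Z &
      forall y L', L = y :: L' -> wp L = wp L' \o cell_transp y].
Proof.
elim: L => [|y L IH] sL IyL.
  by split=> [a _|b _|//]; rewrite /= ?addr0 ?subr0.
have IL := order_ideal_behead sL IyL.
have [IHr IHc _] := IH (path_sorted sL) IL.
have [rowy coly] := row_col_count_new IyL IL.
have [_ rL _] := IyL.
have Ry : in_rect y by apply: rL; rewrite inE eqxx.
have [W1 W2 Hpos] := in_rect_window Ry.
move: (Ry); rewrite /in_rect => /andP[Hy1 Hy2].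
have v1 : wp L (1 - y.1%:Z) = y.2%:Z - y.1%:Z by rewrite IHr // rowy; lia.
have v2 : wp L y.2%:Z = y.2%:Z - y.1%:Z + 1 by rewrite IHc // coly; lia.
have Ew : wp (y :: L) = wp L \o cell_transp y.
  rewrite /cell_transp transp_conj; last 2 first.
  - exact: word_perm_periodic.
  - exact: word_perm_inj.
  by rewrite v1 v2 /= residueE simple_res.
split=> [a Ha|b Hb|y' L' [<- <-] //]; rewrite Ew /= /cell_transp.
  have [<-|Na] := eqVneq y.1 a.
    by rewrite transpL v2 rowy; lia.
  rewrite transpN ?IHr ?add0n //; apply: window_eqmod => //;
    try by rewrite /in_window; lia.
have [<-|Nb] := eqVneq y.2 b.
  by rewrite transpR ?in_rect_neqmod // v1 coly; lia.
rewrite transpN ?IHc ?add0n //; apply: window_eqmod => //;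
  try by rewrite /in_window; lia.
Qed.

Lemma cells_word_cons y L : sorted reading_le (y :: L) -> order_ideal (y :: L) ->
  wp (y :: L) = wp L \o cell_transp y.
Proof. by move=> sL IL; have [_ _ /(_ y L erefl)] := cells_word_spec sL IL. Qed.

Definition row_ok (a : nat) : bool := (0 < a <= k.+1 - c)%N.
Definition col_ok (b : nat) : bool := (0 < b <= c)%N.

Lemma window_cases m : in_window m ->
  (exists2 a, row_ok a & m = 1 - a%:Z) \/ (exists2 b, col_ok b & m = b%:Z).
Proof.
rewrite /in_window /row_ok /col_ok => Hm; have [m0|m0] := leP m 0.
  by left; exists (absz (1 - m)); lia.
by right; exists (absz m); lia.
Qed.

Section CellTransp.

Variables a b : nat.
Hypotheses (Ha : row_ok a) (Hb : col_ok b).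

Lemma cell_transp_row : cell_transp (a, b) (1 - a%:Z) = b%:Z.
Proof. exact: transpL. Qed.

Lemma cell_transp_col : cell_transp (a, b) b%:Z = 1 - a%:Z.
Proof. by apply: transpR; apply: (@in_rect_neqmod (a, b)); apply/andP. Qed.

Lemma cell_transp_id m : in_window m -> m <> 1 - a%:Z -> m <> b%:Z ->
  cell_transp (a, b) m = m.
Proof.
have [|W1 W2 _] := @in_rect_window (a, b); first exact/andP.
by move=> Hm N1 N2; apply: transpN; apply: window_eqmod.
Qed.

Lemma cell_transp_row_id a' : row_ok a' -> a' <> a ->
  cell_transp (a, b) (1 - a'%:Z) = 1 - a'%:Z.
Proof.
move: Hb; rewrite /row_ok /col_ok => Hb' Ha' Na; apply: cell_transp_id; [|lia|lia].
by rewrite /in_window; lia.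
Qed.

Lemma cell_transp_col_id b' : col_ok b' -> b' <> b ->
  cell_transp (a, b) b'%:Z = b'%:Z.
Proof.
move: Ha; rewrite /row_ok /col_ok => Ha' Hb' Nb; apply: cell_transp_id; [|lia|lia].
by rewrite /in_window; lia.
Qed.

End CellTransp.

(** * The permutation of a fixed diagram and the effect of removing cells *)

Section Shape.

Variable L0 : seq (nat * nat).
Hypothesis sorted_L0 : sorted reading_le L0.
Hypothesis ideal_L0 : order_ideal L0.

Local Notation w := (wp L0).

(** Follows from the weakly decreasing row lengths; with [shape_cols] it is the Grassmannian
    property. *)
Lemma shape_rows a a' : (0 < a < a')%N -> (a' <= k.+1 - c)%N ->
  w (1 - a'%:Z) < w (1 - a%:Z).
Proof.
move=> Ha Ha'; have [wr _ _] := cells_word_spec sorted_L0 ideal_L0.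
rewrite !wr; [|lia|lia].
suff : (row_count L0 a' <= row_count L0 a)%N by lia.
have [->//|b0] := posnP (row_count L0 a').
rewrite -mem_row_count //; [|lia]; have [_ _ dL] := ideal_L0.
apply: (dL (a', row_count L0 a')) => /=; [|lia|lia].
by rewrite mem_row_count //; lia.
Qed.

Lemma shape_cols b b' : (0 < b < b')%N -> (b' <= c)%N -> w b%:Z < w b'%:Z.
Proof.
move=> Hb Hb'; have [_ wc _] := cells_word_spec sorted_L0 ideal_L0.
rewrite !wc; [|lia|lia].
suff : (col_count L0 b' <= col_count L0 b)%N by lia.
have [->//|a0] := posnP (col_count L0 b').
rewrite -mem_col_count //; [|lia]; have [_ _ dL] := ideal_L0.
apply: (dL (col_count L0 b', b')) => /=; [|lia|lia].
by rewrite mem_col_count //; lia.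
Qed.

(** For a cell of the diagram b is at most the row length and a at most the column height; for any
    other cell of the rectangle both inequalities fail. *)
Lemma shape_mem a b : in_rect (a, b) ->
  ((a, b) \in L0) = (w b%:Z < w (1 - a%:Z)).
Proof.
move=> Rab; move: (Rab); rewrite /in_rect /= => /andP[Ha Hb].
have [wr wc _] := cells_word_spec sorted_L0 ideal_L0.
have a0 : (0 < a)%N by lia.
have b0 : (0 < b)%N by lia.
rewrite wr // wc //.
have Er := mem_row_count ideal_L0 a0 b0; have Ec := mem_col_count ideal_L0 a0 b0.
by case: ((a, b) \in L0) Er Ec; lia.
Qed.

Lemma shape_windowed : windowed w.
Proof.
have: forall L, sorted reading_le L -> order_ideal L -> windowed (wp L).
  elim=> [_ _ m //|y L IH sL IL]; rewrite cells_word_cons //.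
  have [_ rL _] := IL; have [|W1 W2 _] := @in_rect_window y.
    by apply: rL; rewrite inE eqxx.
  apply: windowed_transp => //.
  by apply: IH; [apply: path_sorted sL|apply: order_ideal_behead sL IL].
exact.
Qed.

(** Each cell added creates an inversion, so the length grows at every letter. *)
Lemma shape_length : coxeter_length k w = size L0.
Proof.
have: forall L, sorted reading_le L -> order_ideal L ->
    coxeter_length k (wp L) = size L.
  elim=> [_ _|y L IH sL IL].
    by apply/eqP; rewrite -leqn0 (coxeter_length_word [::]).
  have sL' := path_sorted sL; have IL' := order_ideal_behead sL IL.
  have [_ rL _] := IL.
  have Ry : in_rect y by apply: rL; rewrite inE eqxx.
  have Nm := in_rect_neqmod Ry; have [W1 W2 Hp] := in_rect_window Ry.
  have Ew := cells_word_cons sL IL.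
  apply/eqP; rewrite eqn_leq; apply/andP; split.
    by apply: leq_trans (coxeter_length_word _) _; rewrite size_map.
  have [wr wc _] := cells_word_spec sL' IL'.
  have [rowy coly] := row_col_count_new IL IL'.
  have EL : wp L = wp (y :: L) \o tr (1 - y.1%:Z) y.2%:Z.
    by rewrite Ew /cell_transp comp_transpK.
  rewrite -[size _]/(size L).+1 -(IH sL' IL') {1}EL.
  apply: coxeter_length_transp; [exact: affine_word| |by lia].
  rewrite Ew /= /cell_transp transpL transpR //.
  move: Ry; rewrite /in_rect => /andP[Hy1 Hy2].
  by rewrite wr // wc // rowy coly; lia.
exact.
Qed.

Lemma foldl_comp (f x : int -> int) C :
  foldl (fun z y => z \o cell_transp y) (f \o x) C =
  f \o foldl (fun z y => z \o cell_transp y) x C.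
Proof. by elim: C x => //= y C IH x; rewrite -IH. Qed.

Definition removed (X : seq (nat * nat)) : int -> int :=
  wp [seq y <- L0 | y \notin X].

(* Deleting the letter of the cell y from a reading word multiplies the
   permutation on the right by cell_transp y, whichever cells read before y have
   already been deleted. *)
Lemma removedE X : removed X =
  foldl (fun z y => z \o cell_transp y) w [seq y <- L0 | y \in X].
Proof.
rewrite /removed; elim: L0 sorted_L0 ideal_L0 => [//|y L IH] sL IL.
have sL' := path_sorted sL; have IL' := order_ideal_behead sL IL.
have Ew := cells_word_cons sL IL.
have [_ rL _] := IL.
have Ry : in_rect y by apply: rL; rewrite inE eqxx.
have {}IH := IH sL' IL'.
rewrite /=; case: ifPn => [yX|yX].
  by rewrite (negPf yX) /= IH -foldl_comp.
rewrite negbK in yX; rewrite yX /= IH.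
congr foldl; rewrite -[simple _ \o _]/(wp (y :: L)) Ew.
by rewrite /cell_transp comp_transpK // in_rect_neqmod.
Qed.

Lemma L0_ok a b : (a, b) \in L0 -> row_ok a /\ col_ok b.
Proof. by have [_ rL _] := ideal_L0; move=> /rL/andP. Qed.

Lemma shape_cols_lt b b' : col_ok b -> col_ok b' ->
  (w b%:Z < w b'%:Z) = (b < b')%N.
Proof.
rewrite /col_ok => Hb Hb'; have [lt_b|lt_b|->] := ltngtP b b'.
- by apply: shape_cols; lia.
- by apply/negbTE; rewrite -leNgt; apply/ltW/shape_cols; lia.
- by rewrite ltxx.
Qed.

Lemma L0_lt a b : (a, b) \in L0 -> w b%:Z < w (1 - a%:Z).
Proof. by move=> Lab; rewrite -shape_mem //; case: ideal_L0 => _ ->. Qed.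

Lemma L0_mem a b : row_ok a -> col_ok b -> w b%:Z < w (1 - a%:Z) ->
  (a, b) \in L0.
Proof. by move=> Ha Hb; rewrite -shape_mem // /in_rect; apply/andP. Qed.

(** * Strong strips *)

(** The minimum of w (1 - a) and of the w b with b in [P]. If [P] holds columns of cells of row a,
    it is w b for the leftmost such b, or w (1 - a) if there is none. *)
Definition row_min (P : pred nat) (a : nat) (v : int) : Prop :=
  [/\ v = w (1 - a%:Z) \/ exists2 b, P b & v = w b%:Z, v <= w (1 - a%:Z) &
      forall b, P b -> v <= w b%:Z].

Lemma row_min_inj P a v v' : row_min P a v -> row_min P a v' -> v = v'.
Proof.
have le P' u u' : row_min P' a u -> row_min P' a u' -> u <= u'.
  by move=> [_ le_u leP] [[->|[b /leP le_b ->]] _ _].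
by move=> H H'; apply/eqP; rewrite eq_le !(le P).
Qed.

Lemma eq_row_min P Q a v : P =1 Q -> row_min P a v -> row_min Q a v.
Proof.
move=> PQ [H1 H2 H3]; split=> // [|b]; last by rewrite -PQ; apply: H3.
by case: H1 => [->|[b Pb ->]]; [left|right; exists b; rewrite -?PQ].
Qed.

(* A column position b of a removed cell holds the label of the strip edge that
   removed the cell. *)
Definition state (x : int -> int) (X : seq (nat * nat)) : Prop :=
  [/\ affine_perm k x, windowed x,
      forall a, row_ok a -> row_min (fun b => (a, b) \in X) a (x (1 - a%:Z)),
      forall a b, (a, b) \in X ->
        row_min (fun b' => ((a, b') \in X) && (b < b')%N) a (x b%:Z) &
      forall b, col_ok b -> (forall a, (a, b) \notin X) -> x b%:Z = w b%:Z].

Lemma eq_state x X Y : X =i Y -> state x X -> state x Y.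
Proof.
move=> XY [Ax Wx rx cx fx]; split=> // [a /rx|a b|b Hb NY].
- by apply: eq_row_min => b; rewrite XY.
- by rewrite -XY => /cx; apply: eq_row_min => b'; rewrite XY.
- by apply: fx => // a; rewrite XY.
Qed.

(** The clauses of [state] fix the values at all row and column positions of the window, hence
    everywhere by periodicity. *)
Lemma state_inj x y X : state x X -> state y X -> x = y.
Proof.
move=> [[_ Px _] _ rx cx fx] [[_ Py _] _ ry cy fy].
apply: (windowed_eq Px Py) => m /window_cases[[a Ha ->]|[b Hb ->]].
  exact: row_min_inj (rx a Ha) (ry a Ha).
have [[a Xab]|NX] := pselect (exists a, (a, b) \in X).
  exact: row_min_inj (cx a b Xab) (cy a b Xab).
have {}NX a : (a, b) \notin X by apply/negP => Xab; apply: NX; exists a.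
by rewrite fx ?fy.
Qed.

Lemma state0 : state w [::].
Proof.
split=> [||a Ha|//|//]; first exact: affine_word.
  exact: shape_windowed.
by split=> //; left.
Qed.

Lemma state_lt x X a b : state x X -> {subset X <= L0} -> (a, b) \in L0 ->
  (forall b', (a, b') \in X -> (b < b')%N) -> w b%:Z < x (1 - a%:Z).
Proof.
move=> [_ _ rx _ _] XL Lab lt_b; have [Ha Hb] := L0_ok Lab.
have [[->|[b' Xab' ->]] _ _] := rx a Ha; first exact: L0_lt.
have [_ Hb'] := L0_ok (XL _ Xab').
by rewrite shape_cols_lt //; apply: lt_b.
Qed.

Lemma state_cons x X a b : state x X -> {subset X <= L0} -> (a, b) \in L0 ->
  (forall a', (a', b) \notin X) -> (forall b', (a, b') \in X -> (b < b')%N) ->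
  state (x \o cell_transp (a, b)) ((a, b) :: X).
Proof.
move=> Sx XL Lab NX lt_b; have wbx := state_lt Sx XL Lab lt_b.
have [Ax Wx rx cx fx] := Sx; have [Ha Hb] := L0_ok Lab.
have [|W1 W2 Hp] := @in_rect_window (a, b); first exact/andP.
rewrite /= in W1 W2 Hp.
have xb : x b%:Z = w b%:Z by apply: fx.
have Xcol a' b' : (a', b') \in X -> b' <> b /\ col_ok b'.
  move=> Xab'; split; last by case: (L0_ok (XL _ Xab')).
  by move=> Eb; have := NX a'; rewrite -Eb Xab'.
split.
- apply: affine_transp => //=; last by lia.
  by rewrite xb.
- exact: windowed_transp.
- move=> a' Ha' /=; have [->|/eqP Na] := eqVneq a' a.
    rewrite cell_transp_row xb; split.
    + by right; exists b; rewrite // inE eqxx.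
    + exact/ltW/L0_lt.
    + move=> b'; rewrite inE => /orP[/eqP[->]//|Xab'].
      have [_ Hb'] := Xcol _ _ Xab'.
      by apply/ltW; rewrite shape_cols_lt //; apply: lt_b.
  rewrite cell_transp_row_id //; apply: eq_row_min (rx a' Ha') => b'.
  by rewrite inE xpair_eqE; case: eqP Na.
- move=> a' b'; rewrite inE => /orP[/eqP[-> ->]|Xab'].
    rewrite /= cell_transp_col //; apply: eq_row_min (rx a Ha) => b''.
    rewrite inE xpair_eqE eqxx /=; case: eqP => [->|_] /=.
      by rewrite (negPf (NX a)) ltnn.
    by apply/idP/andP => [Xab|[]//]; split=> //; apply: lt_b.
  have [Nb Hb'] := Xcol _ _ Xab'.
  rewrite /= cell_transp_col_id //; apply: eq_row_min (cx _ _ Xab') => b''.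
  rewrite inE xpair_eqE; case: eqP => [Ea|//]; case: eqP => [->|//] /=.
  rewrite (negPf (NX _)) /=; apply/esym/negbTE; rewrite -leqNgt ltnW //.
  by apply: lt_b; rewrite -Ea.
- move=> b' Hb' NX'; have Nb : b' <> b.
    by move=> Eb; have := NX' a; rewrite Eb inE eqxx.
  rewrite /= cell_transp_col_id //; apply: fx => // a'.
  by have := NX' a'; rewrite inE => /norP[].
Qed.

(** Condition (C1); [no_corner] below is condition (C2). *)
Definition distinct_cols (X : seq (nat * nat)) : Prop :=
  forall y z, y \in X -> z \in X -> y != z -> y.2 != z.2.

Definition no_corner (X : seq (nat * nat)) : Prop :=
  forall y z, y \in X -> z \in X -> (z.1 < y.1)%N -> (y.2 < z.2)%N ->
    (y.1, z.2) \notin L0.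

Lemma distinct_colsP X a a' b : distinct_cols X -> (a, b) \in X ->
  (a', b) \in X -> a = a'.
Proof.
move=> dX Xab Xab'; apply/eqP/negPn/negP => Na.
by have := dX _ _ Xab Xab'; rewrite xpair_eqE (negPf Na) /= eqxx => /(_ isT).
Qed.

(** The reading order removes the cells of a row from right to left, and columns do not repeat, so
    [state_cons] applies to each cell. *)
Lemma removed_state (X : seq (nat * nat)) :
  {subset X <= L0} -> distinct_cols X -> state (removed X) X.
Proof.
move=> XL dX; rewrite removedE //.
have : state (foldl (fun z y => z \o cell_transp y) w [seq y <- L0 | y \in X])
    [seq y <- L0 | y \in X]; last first.
  apply: eq_state => y; rewrite mem_filter.
  by apply/andP/idP => [[]//|Xy]; split=> //; apply: XL.
have : {subset [seq y <- L0 | y \in X] <= X}.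
  by move=> y; rewrite mem_filter => /andP[].
have : uniq [seq y <- L0 | y \in X] by have [uL _ _] := ideal_L0; apply: filter_uniq.
have : sorted reading_le [seq y <- L0 | y \in X].
  by apply: sorted_filter sorted_L0; apply: reading_le_trans.
rewrite sorted_pairwise; last exact: reading_le_trans.
elim/last_ind: [seq y <- L0 | y \in X] => [_ _ _|F [a b] IH].
  exact: state0.
rewrite pairwise_rcons rcons_uniq => /andP[/allP leF pF] /andP[NF uF] FX.
have FX' : {subset F <= X} by move=> y Fy; apply: FX; rewrite mem_rcons inE Fy orbT.
have Xab : (a, b) \in X by apply: FX; rewrite mem_rcons inE eqxx.
rewrite foldl_rcons.
apply: eq_state (state_cons (IH pF uF FX') _ _ _ _) => [y|y Fy||a'|b' Fab'].
- by rewrite mem_rcons.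
- exact/XL/FX'.
- exact: XL.
- apply/negP => Fab'; have Ea := distinct_colsP dX Xab (FX' _ Fab').
  by rewrite Ea Fab' in NF.
- have := leF _ Fab'; rewrite /reading_le /= ltnn eqxx /= leq_eqVlt.
  by case/orP => // /eqP Eb; rewrite Eb Fab' in NF.
Qed.

(* The cover condition on rows, in the form that survives later removals. *)
Definition row_gap (x : int -> int) (X : seq (nat * nat)) : Prop :=
  forall a b a', (a, b) \in X -> (0 < a' < a)%N ->
    x (1 - a'%:Z) < w b%:Z \/ x b%:Z < x (1 - a'%:Z).

(** The invariant along a strip: x is the current permutation and [X] lists the cells used so
    far. *)
Definition good (x : int -> int) (X : seq (nat * nat)) : Prop :=
  [/\ {subset X <= L0}, distinct_cols X, no_corner X, state x X & row_gap x X].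

(** * Extending a strip by one edge *)

Section Step.

Variables (x : int -> int) (X : seq (nat * nat)) (a b : nat).
Hypotheses (gX : good x X) (Ha : row_ok a) (Hb : col_ok b).
Hypothesis cov : covers x (1 - a%:Z) b%:Z.
Hypothesis lt_labels : {in X, forall y, x (1 - a%:Z) < x y.2%:Z}.

(** A used column b would hold an earlier label, larger than x (1 - a), whereas the cover has x b <
    x (1 - a). *)
Lemma step_new_col a' : (a', b) \notin X.
Proof.
have [_ _ lt_x _] := cov; apply/negP => /lt_labels /= /lt_trans/(_ lt_x).
by rewrite ltxx.
Qed.

Lemma step_col_val : x b%:Z = w b%:Z.
Proof. by have [_ _ _ [_ _ _ _ fx] _] := gX; apply: fx => // a'; apply: step_new_col. Qed.

Lemma step_lt : w b%:Z < x (1 - a%:Z).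
Proof. by rewrite -step_col_val; have [] := cov. Qed.

Lemma step_mem : (a, b) \in L0.
Proof.
have [_ _ _ [_ _ rx _ _] _] := gX; have [_ le_x _] := rx a Ha.
exact/L0_mem/(lt_le_trans step_lt).
Qed.

Lemma step_left b' : (a, b') \in X -> (b < b')%N.
Proof.
move=> Xab'; have [XL _ _ [_ _ rx _ _] _] := gX; have [_ _ le_x] := rx a Ha.
have [_ Hb'] := L0_ok (XL _ Xab').
by rewrite -shape_cols_lt //; apply: lt_le_trans step_lt (le_x _ Xab').
Qed.

Lemma step_row m a' : m = 1 - a'%:Z -> (0 < a' < a)%N ->
  x m < w b%:Z \/ x (1 - a%:Z) < x m.
Proof.
move=> -> Ha'; have [_ _ _ between] := cov; rewrite -step_col_val.
by apply: between; move: Hb; rewrite /col_ok => Hb'; lia.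
Qed.

Lemma step_corner_l a' b' : (a', b') \in X -> (a' < a)%N -> (b < b')%N ->
  (a, b') \notin L0.
Proof.
move=> Xab' lt_a lt_b; apply/negP => Lab'.
have [XL dX nX [_ _ rx cx _] _] := gX.
have [Ha' Hb'] := L0_ok (XL _ Xab').
have Hra' : (0 < a' < a)%N by move: Ha'; rewrite /row_ok => /andP[-> _].
have [src _ le_row] := rx a' Ha'.
(* If x (1 - a') is below w b, it equals w b'' for a used cell of row a' left of column b. The label
   stored at b'' is at most w b', and it exceeds the new label x (1 - a). *)
have lt_x : x (1 - a%:Z) < w b'%:Z.
  have [lt_w|/lt_le_trans] := step_row erefl Hra'; last by apply; apply: le_row.
  have lt_b'x := le_lt_trans (le_row _ Xab') (L0_lt (XL _ Xab')).
  case: src => [Ex|[b'' Xab'' Ex]].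
    by rewrite Ex ltxx in lt_b'x.
  have [_ Hb''] := L0_ok (XL _ Xab'').
  rewrite Ex shape_cols_lt // in lt_w.
  have [_ _ le_col] := cx _ _ Xab''.
  apply: lt_le_trans (lt_labels Xab'') (le_col _ _).
  by rewrite Xab' (ltn_trans lt_w).
(* If x (1 - a) = w (1 - a), then [lt_x] puts (a, b') outside the diagram; otherwise x (1 - a) = w
   b0 with b0 < b', and (C2) for [X] applies. *)
have [[Ex|[b0 Xab0 Ex]] _ _] := rx a Ha.
  by have := lt_trans lt_x (L0_lt Lab'); rewrite Ex ltxx.
have [_ Hb0] := L0_ok (XL _ Xab0).
rewrite Ex shape_cols_lt // in lt_x.
by have := nX _ _ Xab0 Xab' lt_a lt_x; rewrite /= Lab'.
Qed.

(** By [row_gap], x (1 - a) is below w b' or above x b'. The first contradicts w b' < w b < x (1 -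
    a), the second the decrease of labels. *)
Lemma step_corner_r a' b' : (a', b') \in X -> (a < a')%N -> (b' < b)%N -> False.
Proof.
move=> Xab' lt_a lt_b; have [XL _ _ _ gap] := gX.
have [_ Hb'] := L0_ok (XL _ Xab').
have Hra : (0 < a < a')%N by move: Ha; rewrite /row_ok => /andP[-> _].
have := lt_b; rewrite -shape_cols_lt // => lt_w.
have [lt_x|lt_x] := gap _ _ _ Xab' Hra.
  by have := lt_trans (lt_trans lt_w step_lt) lt_x; rewrite ltxx.
by have := lt_trans lt_x (lt_labels Xab'); rewrite ltxx.
Qed.

Local Notation y := (x \o cell_transp (a, b)).

Lemma step_keep : {in X, forall z, y z.2%:Z = x z.2%:Z}.
Proof.
move=> [a' b'] Xab' /=; have [XL _ _ _ _] := gX.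
have [_ Hb'] := L0_ok (XL _ Xab'); rewrite cell_transp_col_id // => Eb.
by have := step_new_col a'; rewrite -Eb Xab'.
Qed.

Lemma step_good : good y ((a, b) :: X).
Proof.
have [XL dX nX Sx gap] := gX.
have Sy := state_cons Sx XL step_mem step_new_col step_left.
split=> //.
- by move=> z; rewrite inE => /orP[/eqP->|/XL//]; apply: step_mem.
- move=> [a1 b1] [a2 b2]; rewrite !inE => /orP[/eqP[-> ->]|X1] /orP[/eqP[-> ->]|X2].
  + by rewrite eqxx.
  + by move=> _ /=; apply/eqP => Eb; have := step_new_col a2; rewrite Eb X2.
  + by move=> _ /=; apply/eqP => Eb; have := step_new_col a1; rewrite -Eb X1.
  + exact: dX.
- move=> [a1 b1] [a2 b2]; rewrite !inE => /orP[/eqP[-> ->]|X1] /orP[/eqP[-> ->]|X2].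
  + by rewrite ltnn.
  + exact: step_corner_l.
  + by move=> lt_a lt_b; case: (step_corner_r X1 lt_a lt_b).
  + exact: nX.
(* For the new cell the gap is the cover condition on rows. For an old cell only row a has changed:
   its value drops to w b, and decreasing labels leave only the alternative of lying below w b1. *)
move=> a1 b1 a'; rewrite inE => /orP[/eqP[-> ->]|X1] Ha'.
  have Hra' : row_ok a' by move: Ha Ha'; rewrite /row_ok; lia.
  rewrite /= cell_transp_col // cell_transp_row_id //; last by lia.
  exact: step_row Ha'.
have [Hra1 _] := L0_ok (XL _ X1).
rewrite [y b1%:Z](step_keep X1) /=.
have [Ea|/eqP Na] := eqVneq a' a.
  rewrite Ea in Ha' *; rewrite cell_transp_row step_col_val; left.
  have [lt_x|lt_x] := gap _ _ _ X1 Ha'; first exact: lt_trans step_lt lt_x.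
  by have := lt_trans lt_x (lt_labels X1); rewrite ltxx.
have Hra' : row_ok a' by move: Hra1 Ha'; rewrite /row_ok; clear; lia.
by rewrite cell_transp_row_id //; apply: gap X1 Ha'.
Qed.

End Step.

Definition edge_cell (e : int * int * (int -> int)) : nat * nat :=
  (absz (1 - e.1.1), absz e.1.2).

Lemma strip_end_rcons x p e : strip_end x (rcons p e) = e.2.
Proof. by rewrite /strip_end map_rcons last_rcons. Qed.

Lemma strong_path_rcons x p e : strong_path k x (rcons p e) <->
  strong_path k x p /\ strong_edge k (strip_end x p) e.
Proof.
elim: p x => [|f p IH] x; rewrite [rcons _ _]/=; first by split=> /= [[]|[]].
rewrite /= IH /strip_end /=; split; first by move=> [H1 [H2 H3]].
by move=> [[H1 H2] H3].
Qed.

Lemma strong_edgeP x e : affine_perm k x -> windowed x ->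
  strong_edge k x e <-> exists a b,
    [/\ row_ok a, col_ok b, covers x (1 - a%:Z) b%:Z &
        e = (1 - a%:Z, b%:Z, x \o cell_transp (a, b))].
Proof.
case: e => [[i j] y] Ax Wx; split=> [[_ Ay El Hij [Nij Ey]]|].
  have Ey' : y = x \o tr i j by rewrite -Ey comp_transpK.
  have cov : covers x i j by apply/coversP; rewrite // -?Ey'.
  have [Wi Wj _ _] := cov.
  have Ei : i = 1 - (absz (1 - i))%:Z by lia.
  have Ej : j = (absz j)%:Z by lia.
  exists (absz (1 - i)), (absz j); rewrite /cell_transp /= -Ei -Ej.
  split=> //; last by rewrite Ey'.
    by move: Wi Hij; rewrite /in_window /row_ok; clear; lia.
  by move: Wj Hij; rewrite /in_window /col_ok; clear -k_gt0 le_ck; lia.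
move=> [a [b [Ha Hb cov [-> -> ->]]]].
have Rab : in_rect (a, b) by apply/andP.
have [_ _ Hp] := in_rect_window Rab; have Nab := in_rect_neqmod Rab.
have [Ay El] := (coversP Ax Wx Hp Nab).2 cov.
by split=> //; split=> //; apply: comp_transpK.
Qed.

Local Notation labels p := [seq edge_label e | e <- p].
Local Notation cells p := [seq edge_cell e | e <- p].
Local Notation gtz := (fun u v : int => v < u).

Lemma gtz_trans : transitive gtz.
Proof. by move=> u v t /= H1 H2; apply: lt_trans H2 H1. Qed.

Lemma sorted_labels_rcons p e : sorted gtz (labels (rcons p e)) =
  all (fun f => edge_label e < edge_label f) p && sorted gtz (labels p).
Proof.
rewrite map_rcons !sorted_pairwise; try exact: gtz_trans.
by rewrite pairwise_rcons all_map.
Qed.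

Lemma edge_cellE a b x : edge_cell (1 - a%:Z, b%:Z, x) = (a, b).
Proof. by rewrite /edge_cell /=; congr (_, _); lia. Qed.

(** Each edge stores its label at the column position of its cell, where it stays because columns
    are not reused. Decreasing labels thus become the hypothesis [lt_labels] of the next step. *)
Lemma strip_good p : strong_path k w p -> sorted gtz (labels p) ->
  [/\ good (strip_end w p) (cells p), uniq (cells p) &
      {in p, forall e, edge_label e = strip_end w p (edge_cell e).2%:Z}].
Proof.
elim/last_ind: p => [_ _|p e IH]; first by split=> //; split=> //; apply: state0.
rewrite strong_path_rcons sorted_labels_rcons => -[pw ew] /andP[/allP lt_e sp].
have [gp up Ep] := IH pw sp; have [_ _ _ [Ax Wx _ _ _] _] := gp.
have [a [b [Ha Hb cov Ee]]] := (strong_edgeP e Ax Wx).1 ew.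
have Ce : edge_cell e = (a, b) by rewrite Ee edge_cellE.
have Le : edge_label e = strip_end w p (1 - a%:Z).
  by rewrite Ee /= cell_transp_col.
have lt_labels : {in cells p, forall y, strip_end w p (1 - a%:Z) < strip_end w p y.2%:Z}.
  by move=> y /mapP[f pf ->]; rewrite -Le -Ep //; apply: lt_e.
have E2 : e.2 = strip_end w p \o cell_transp (a, b) by rewrite Ee.
rewrite strip_end_rcons map_rcons Ce E2.
have XE : (a, b) :: cells p =i rcons (cells p) (a, b) by move=> y; rewrite mem_rcons.
split.
- have [XL dX nX Sx gap] := step_good gp Ha Hb cov lt_labels.
  split.
  + by move=> y; rewrite -XE; apply: XL.
  + by move=> y z; rewrite -!XE; apply: dX.
  + by move=> y z; rewrite -!XE; apply: nX.
  + exact: eq_state Sx.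
  + by move=> a1 b1 a2; rewrite -XE; apply: gap.
- by rewrite rcons_uniq up andbT; apply: step_new_col cov lt_labels _.
move=> f; rewrite mem_rcons inE => /orP[/eqP->|pf].
  by rewrite Ce Ee /=.
rewrite Ep // (step_keep gp Ha Hb cov lt_labels) //; exact: map_f.
Qed.

(** * Removing last the cell with the smallest label *)

Section LastCell.

Variables (X Y : seq (nat * nat)) (a b : nat) (x : int -> int).
Hypotheses (XL : {subset X <= L0}) (dX : distinct_cols X) (nX : no_corner X).
Hypothesis Xab : (a, b) \in X.
Hypothesis min_ab : {in X, forall y, removed X b%:Z <= removed X y.2%:Z}.
Hypothesis YE : forall y, (y \in Y) = (y \in X) && (y != (a, b)).
Hypothesis Sx : state x Y.

Lemma last_sub : {subset Y <= X}.
Proof. by move=> y; rewrite YE => /andP[]. Qed.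

Lemma last_ok : row_ok a /\ col_ok b.
Proof. exact/L0_ok/XL. Qed.

Lemma last_new_col a' : (a', b) \notin Y.
Proof.
rewrite YE; apply/negP => /andP[Xa' /eqP]; apply; congr (_, _).
exact: distinct_colsP dX Xa' Xab.
Qed.

(** A remaining cell of the row in a column b' < b would have label at most w b, which is below the
    label of (a, b), against minimality. *)
Lemma last_left b' : (a, b') \in Y -> (b < b')%N.
Proof.
move=> Yb'; have Xb' := last_sub Yb'; have [Ha Hb] := last_ok.
have [_ Hb'] := L0_ok (XL Xb').
rewrite ltnNge; apply/negP; rewrite leq_eqVlt => /orP[/eqP Eb|lt_b].
  by have := last_new_col a; rewrite -Eb Yb'.
have [_ _ _ cS _] := removed_state XL dX.
have [_ _ /(_ b)] := cS _ _ Xb'; rewrite Xab lt_b => /(_ isT) le_b.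
have : w b%:Z < removed X b%:Z.
  have [[->|[b0 /andP[Xb0 lt_b0] ->]] _ _] := cS _ _ Xab; first exact/L0_lt/XL.
  by rewrite shape_cols_lt //; have [] := L0_ok (XL Xb0).
move=> /(le_lt_trans le_b) /(lt_le_trans)/(_ (min_ab Xb')).
by rewrite ltxx.
Qed.

Lemma last_removed : removed X = x \o cell_transp (a, b).
Proof.
apply: (@state_inj _ _ X); first exact: removed_state.
have YL : {subset Y <= L0} by move=> y /last_sub/XL.
apply: eq_state (state_cons Sx YL (XL Xab) last_new_col last_left) => y.
by rewrite inE YE; case: eqP => [->|_]; rewrite ?Xab ?andbT.
Qed.

Lemma last_label : removed X b%:Z = x (1 - a%:Z).
Proof. by have [Ha Hb] := last_ok; rewrite last_removed /= cell_transp_col. Qed.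

Lemma last_keep : {in Y, forall y, removed X y.2%:Z = x y.2%:Z}.
Proof.
move=> [a' b'] Yab' /=; have [Ha Hb] := last_ok.
have [_ Hb'] := L0_ok (XL (last_sub Yab')).
rewrite last_removed /= cell_transp_col_id // => Eb.
by have := last_new_col a'; rewrite -Eb Yab'.
Qed.

Lemma last_lt : {in Y, forall y, x (1 - a%:Z) < x y.2%:Z}.
Proof.
move=> [a' b'] Yab'; rewrite -last_label -(last_keep Yab') /=.
have Xab' := last_sub Yab'; rewrite lt_neqAle (min_ab Xab') andbT.
apply/eqP => /(bij_inj (word_perm_bij _)) [Eb].
by have := last_new_col a'; rewrite Eb Yab'.
Qed.

Lemma last_covers : covers x (1 - a%:Z) b%:Z.
Proof.
have [Ha Hb] := last_ok; have [[Bx _ _] _ rx cx fx] := Sx.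
have [|W1 W2 Hp] := @in_rect_window (a, b); first exact/andP.
have YL : {subset Y <= L0} by move=> y /last_sub/XL.
have xb : x b%:Z = w b%:Z by apply: fx => // a'; apply: last_new_col.
split=> //; rewrite xb; first exact: (state_lt Sx YL (XL Xab) last_left).
move=> m Hm; have Wm : in_window m.
  by move: W1 W2 Hm; rewrite /in_window /=; clear; lia.
have [[a' Ha' Em]|[b' Hb' Em]] := window_cases Wm.
  (* A row position: a value below x (1 - a) must be w b' for a cell (a', b') with (a, b') in the
     diagram, by [shape_rows]; (C1) and (C2) then force b' < b. *)
  have lt_a : (0 < a' < a)%N by move: Hm Ha'; rewrite Em /row_ok; clear; lia.
  have [lt_x|lt_x|/(bij_inj Bx) Exm] := ltgtP (x m) (x (1 - a%:Z)); last 2 first.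
  - by right.
  - by move: Hm; rewrite Exm ltxx.
  left; have [_ le_x _] := rx _ Ha.
  have := lt_le_trans lt_x le_x; rewrite Em => lt_w.
  have [[Ex|[b' Yab' Ex]] _ _] := rx _ Ha'.
    have := shape_rows lt_a; rewrite -Ex => /(_ _)/lt_trans/(_ lt_w).
    by rewrite ltxx => H; have := H ltac:(by case/andP: Ha).
  rewrite Ex in lt_w *; have [_ Hb'] := L0_ok (YL _ Yab').
  rewrite shape_cols_lt // ltnNge leq_eqVlt; apply/negP => /orP[/eqP Eb|lt_b].
    by have := last_new_col a'; rewrite Eb Yab'.
  have [_ lt_a'] := andP lt_a.
  by have := nX Xab (last_sub Yab') lt_a' lt_b; rewrite /= L0_mem.
have lt_b : (b' < b)%N by move: Hm; rewrite Em; clear; lia.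
rewrite Em; have [[a' Yab']|NY] := pselect (exists a', (a', b') \in Y).
  by right; apply: last_lt Yab'.
left; rewrite fx ?shape_cols_lt // => a'.
by apply/negP => Yab'; apply: NY; exists a'.
Qed.

End LastCell.

(** The column values of [removed X] are the labels to be realised. The cell with the smallest one
    goes last, and induction builds the strip for the others. *)
Lemma strip_exists (m : nat) (X : seq (nat * nat)) : size X = m -> uniq X ->
  {subset X <= L0} -> distinct_cols X -> no_corner X ->
  exists p, [/\ size p = m, strong_path k w p, sorted gtz (labels p) &
               cells p =i X].
Proof.
elim: m X => [|m IH] X size_X uX XL dX nX.
  by exists [::]; split=> // y; move/size0nil: size_X => ->.
have [|[a b] Xab min_ab] := @seq_argmin _ (fun y => removed X y.2%:Z) X.
  by rewrite -size_eq0 size_X.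
have YE y : (y \in rem (a, b) X) = (y \in X) && (y != (a, b)).
  by rewrite (rem_filter _ uX) mem_filter /= andbC.
have YX := last_sub YE.
have [|||||p [size_p pw sp cp]] := IH (rem (a, b) X).
- by rewrite size_rem // size_X.
- exact: rem_uniq.
- by move=> y /YX/XL.
- by move=> y z /YX Xy /YX Xz; apply: dX.
- by move=> y z /YX Xy /YX Xz; apply: nX.
have [[_ _ _ Sp _] _ Ep] := strip_good pw sp.
have Sx := eq_state cp Sp; have [Ax Wx _ _ _] := Sx.
have [Ha Hb] := last_ok XL Xab.
have cov := last_covers XL dX nX Xab min_ab YE Sx.
pose e := (1 - a%:Z, b%:Z, strip_end w p \o cell_transp (a, b)).
exists (rcons p e); split.
- by rewrite size_rcons size_p.
- by apply/strong_path_rcons; split=> //; apply/strong_edgeP => //; exists a, b.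
- rewrite sorted_labels_rcons sp andbT; apply/allP => f pf.
  rewrite (Ep _ pf) [edge_label e]/= cell_transp_col //.
  by apply: (last_lt XL dX Xab min_ab YE Sx); rewrite -cp; apply: map_f.
- move=> y; rewrite map_rcons mem_rcons edge_cellE inE cp YE.
  by case: eqP => [->|_]; rewrite ?Xab ?andbT.
Qed.

(** Equal cell sets give equal endpoints, and the labels are read off the endpoint. The last cells,
    having the smallest label, therefore agree, and induction applies. *)
Lemma strip_inj p q : strong_path k w p -> sorted gtz (labels p) ->
  strong_path k w q -> sorted gtz (labels q) -> cells p =i cells q -> p = q.
Proof.
elim/last_ind: p q => [|p e IH] q pw sp qw sq Epq.
  by case: q qw sq Epq => // f q _ _ /(_ (edge_cell f)) /=; rewrite in_nil in_cons eqxx.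
case/lastP: q qw sq Epq => [|q f] qw sq Epq.
  by have := Epq (edge_cell e); rewrite map_rcons mem_rcons inE eqxx.
have [[_ _ _ Sp _] up Lp] := strip_good pw sp.
have [[_ _ _ Sq _] uq Lq] := strip_good qw sq.
have Ex := state_inj (eq_state Epq Sp) Sq.
move: (pw) (sp) (qw) (sq).
rewrite !strong_path_rcons !sorted_labels_rcons.
move=> [pw' ew] /andP[/allP lt_e sp'] [qw' fw] /andP[/allP lt_f sq'].
have mem_e : e \in rcons p e by rewrite mem_rcons inE eqxx.
have mem_f : f \in rcons q f by rewrite mem_rcons inE eqxx.
(* Otherwise each last cell occurs earlier in the other strip, and each of the two labels would be
   smaller than the other. *)
have Ecell : edge_cell e = edge_cell f.
  have : edge_cell e \in cells (rcons q f) by rewrite -Epq; apply: map_f.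
  have : edge_cell f \in cells (rcons p e) by rewrite Epq; apply: map_f.
  rewrite !map_rcons !mem_rcons !inE => /orP[/eqP->//|/mapP[e' pe' Ef]].
  move=> /orP[/eqP->//|/mapP[f' qf' Ee]].
  have mem_e' : e' \in rcons p e by rewrite mem_rcons inE pe' orbT.
  have mem_f' : f' \in rcons q f by rewrite mem_rcons inE qf' orbT.
  have := lt_e _ pe'; have := lt_f _ qf'.
  rewrite (Lp _ mem_e) (Lq _ mem_f) (Lp _ mem_e') (Lq _ mem_f').
  by rewrite -Ee -Ef Ex => H1 /(lt_trans H1); rewrite ltxx.
have Epq' : p = q.
  apply: IH => // y.
  move: up uq (Epq y); rewrite !map_rcons !mem_rcons !inE !rcons_uniq Ecell.
  case: eqP => [->|//] /andP[/negPf-> _] /andP[/negPf-> _] //.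
subst q; have [[_ _ _ [Ax Wx _ _ _] _] _ _] := strip_good pw' sp'.
have [a [b [_ _ _ Ee]]] := (strong_edgeP e Ax Wx).1 ew.
have [a' [b' [_ _ _ Ef]]] := (strong_edgeP f Ax Wx).1 fw.
move: Ecell; rewrite Ee Ef !edge_cellE => -[Ea Eb].
by rewrite Ea Eb.
Qed.

Lemma strong_path_length x p : strong_path k x p ->
  coxeter_length k x = (coxeter_length k (strip_end x p) + size p)%N.
Proof.
elim: p x => [|[[i j] y] p IH] x /=; first by rewrite addn0.
by move=> [[_ _ -> _ _] /IH ->]; rewrite addnS.
Qed.

End Shape.

End Window.

End AffineGroup.

(** * Diagrams of partitions in the rectangle as order ideals *)

Section PartitionDiagram.

Variables (k c : nat) (lam : seq nat).
Hypothesis le_ck : (c <= k)%N.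
Hypothesis lam_part : is_partition lam.
Hypothesis lam_rect : part_contained lam (nseq (k.+1 - c) c).

Definition reading_cells : seq (nat * nat) :=
  sort reading_le (enum_fset (diagram lam)).

Lemma mem_reading_cells : reading_cells =i diagram lam.
Proof. by move=> y; rewrite mem_sort. Qed.

Lemma mem_diagram y :
  (y \in diagram lam) =
  (0 < y.1 <= size lam)%N && (0 < y.2 <= nth 0%N lam y.1.-1)%N.
Proof.
rewrite !inE; apply/allpairsPdep/idP => [[a [b [Ha Hb ->]]]|/andP[Ha Hb]] /=.
  by move: Ha Hb; rewrite !mem_iota; lia.
by exists y.1, y.2; rewrite !mem_iota; split; [lia|lia|case: y {Ha Hb}].
Qed.

Lemma sorted_reading_cells : sorted reading_le reading_cells.
Proof. exact/sort_sorted/reading_le_total. Qed.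

Lemma reading_cells_ideal : order_ideal k c reading_cells.
Proof.
split; first by rewrite sort_uniq fset_uniq.
  move=> [a b]; rewrite mem_reading_cells mem_diagram /in_rect /= => /andP[Ha Hb].
  (* From row k + 2 - c on, [nth] of the rectangle defaults to 0, so containment bounds the number
     of rows as well. *)
  have := lam_rect a.-1; rewrite nth_nseq; case: ltnP => Hl; lia.
move=> [a b] [a' b']; rewrite !mem_reading_cells !mem_diagram /=.
move=> /andP[Hy1 Hy2] Hz1 Hz2.
apply/andP; split; first by lia.
have /andP[sl _] := lam_part.
have geq_trans : transitive geq by move=> ? ? ? /= H1 H2; apply: leq_trans H2 H1.
have := sorted_leq_nth geq_trans leqnn 0%N sl; rewrite /prop_in2 /= => le_nth.
have := le_nth a'.-1 a.-1; rewrite !inE.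
by move=> /(_ ltac:(lia) ltac:(lia) ltac:(lia)); lia.
Qed.

Lemma reading_wordD (X : {fset nat * nat}) :
  reading_word k (diagram lam `\` X)%fset =
  cells_word k [seq y <- reading_cells | y \notin enum_fset X].
Proof.
rewrite /reading_word /cells_word; congr map.
apply: (sorted_eq reading_le_trans reading_le_anti).
- exact/sort_sorted/reading_le_total.
- by apply: sorted_filter sorted_reading_cells; apply: reading_le_trans.
apply: uniq_perm; first by rewrite sort_uniq fset_uniq.
  by apply: filter_uniq; rewrite sort_uniq fset_uniq.
by move=> y; rewrite mem_filter mem_reading_cells mem_sort in_fsetD.
Qed.

End PartitionDiagram.

Theorem theorem4p5 (R : comNzRingType) (k c n : nat) (lam : seq nat) :
  (0 < k)%N -> (c <= k)%N ->
  is_partition lam -> part_contained lam (nseq (k.+1 - c) c) ->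
  down_operator R k n (nc_basis R k (cells_perm k (diagram lam))) =
  \sum_(X \in removable_sets n lam) nc_cells R k (diagram lam `\` X)%fset.
Proof.
move=> k_gt0 le_ck lam_part lam_rect.
have sL := sorted_reading_cells lam.
have iL := reading_cells_ideal le_ck lam_part lam_rect.
pose L0 := reading_cells lam.
pose w := word_perm (cells_word k L0).
have -> : cells_perm k (diagram lam) = w by [].
rewrite down_operatorE //; last exact: affine_word.
(* Only the set of removed cells is kept; the order of the edges is recovered from the labels, so
   this is a bijection onto the removable sets. *)
pose phi (p : seq (int * int * (int -> int))) : {fset nat * nat} :=
  [fset y in [seq edge_cell e | e <- p]]%fset.
have phiE p : enum_fset (phi p) =i [seq edge_cell e | e <- p].
  by move=> y; rewrite -[LHS]/(y \in phi p) !inE.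
rewrite (reindex_fsbig phi (strong_strip k n w)); last first.
  split.
  - move=> p [size_p pw sp].
    have [[XL dX nX Sp _] up _] := strip_good k_gt0 le_ck sL iL pw sp.
    split=> [||y z|y z].
    + by apply/fsubsetP => y; rewrite phiE -mem_reading_cells; apply: XL.
    + rewrite -size_p -(size_map (@edge_cell)); apply: perm_size.
      exact: uniq_perm (fset_uniq _) up (phiE p).
    + by rewrite !phiE; apply: dX.
    + by rewrite !phiE -mem_reading_cells; apply: nX.
  - move=> p q; rewrite !inE => -[size_p pw sp] [size_q qw sq] Epq.
    apply: (strip_inj k_gt0 le_ck sL iL) => // y.
    by rewrite -!phiE Epq.
  - move=> X [XD size_X dX nX].
    have [|||||p [size_p pw sp cp]] :=
      @strip_exists k k_gt0 c le_ck L0 sL iL n (enum_fset X).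
    + by [].
    + exact: fset_uniq.
    + by move=> y Xy; rewrite mem_reading_cells; apply: (fsubsetP XD).
    + by [].
    + by move=> y z Xy Xz lt1 lt2; rewrite mem_reading_cells; apply: nX.
    by exists p => //; apply/fsetP => y; rewrite phiE.
apply: eq_fsbigr => p; rewrite inE => -[size_p pw sp].
have [[XL dX nX Sp _] up _] := strip_good k_gt0 le_ck sL iL pw sp.
have XL' : {subset enum_fset (phi p) <= L0} by move=> y; rewrite phiE; apply: XL.
have dX' : distinct_cols (enum_fset (phi p)) by move=> y z; rewrite !phiE; apply: dX.
have Sr := removed_state k_gt0 le_ck sL iL XL' dX'.
have Er := state_inj k_gt0 le_ck Sp (eq_state (phiE p) Sr).
have Ew : word_perm (reading_word k (diagram lam `\` phi p)%fset) = strip_end w p.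
  by rewrite Er reading_wordD.
(* [nc_basis] uses some reduced word of the endpoint, and the reading word of the remaining cells
   gives the same product once it is reduced. It is, since each edge lowers the length by one and
   deletes one cell. *)
rewrite -Ew; apply: nc_basis_reduced => //.
rewrite /reduced Ew.
have := strong_path_length pw; rewrite (shape_length k_gt0 le_ck sL iL).
move=> El; rewrite -(eqn_add2r (size p)) -El reading_wordD size_map size_filter.
rewrite -[size L0](count_predC (mem (enum_fset (phi p)))) addnC eqn_add2r.
rewrite -size_filter -(size_map edge_cell); apply/eqP/perm_size/uniq_perm => //.
  by have [uL _ _] := iL; apply: filter_uniq.
move=> y; rewrite mem_filter -phiE; apply/idP/andP => [Xy|[]//].
by split=> //; apply: XL'.
Qed.
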